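(* Let $G$ be an arbitrary topological group, let $R$ be a commutative ring, let $\mathcal{U}$ be a cofinal system of open subgroups of $G$, and let $\mathscr{C} = \mathbf{S}_{\mathcal{U}}G$ be the associated orbit category, equipped with the atomic topology; write $\boldsymbol{\mathscr{C}}$ for the resulting site. Then there are equivalences of categories $$RG\text{-Mod}^{\mathrm{dis}} \simeq \mathrm{Sh}(\boldsymbol{\mathscr{C}}, R) \simeq \mathscr{C}^{\mathrm{op}}\text{-Mod} / \mathscr{C}^{\mathrm{op}}\text{-Mod}^{\mathrm{tor}}.$$
   Context: A discrete representation of $G$ over $R$ is an $RG$-module $V$ such that, with the discrete topology on $V$, the action of $G$ is continuous; equivalently $\mathrm{Stab}_G(v)$ is open for every $v \in V$. $RG\text{-Mod}^{\mathrm{dis}}$ is the category of discrete representations and $RG$-homomorphisms. A cofinal system $\mathcal{U}$ of open subgroups is a set of open subgroups of $G$ such that every open subgroup contains a member of $\mathcal{U}$. The orbit category $\mathbf{S}_{\mathcal{U}}G$ has objects the (discrete) $G$-sets $G/H$ with $H \in \mathcal{U}$, and morphisms the $G$-equivariant maps. The atomic topology is the Grothendieck topology in which the covering sieves of an object are all nonempty sieves. $\mathscr{C}^{\mathrm{op}}\text{-Mod}$ is the category of covariant functors $\mathscr{C}^{\mathrm{op}} \to R\text{-Mod}$, i.e. presheaves of $R$-modules on $\mathscr{C}$; $\mathrm{Sh}(\boldsymbol{\mathscr{C}}, R)$ is its full subcategory of sheaves. A $\mathscr{C}^{\mathrm{op}}$-module $V$ is torsion if for every object $x$ and every $v\in V(x)$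 there is a morphism $\alpha: x \to y$ in $\mathscr{C}^{\mathrm{op}}$ with $V(\alpha)(v) = 0$; $\mathscr{C}^{\mathrm{op}}\text{-Mod}^{\mathrm{tor}}$ is the full (Serre) subcategory of torsion modules, and the last category is the Serre quotient. *)

(* Defs.v *)
From HB Require Import structures.
From mathcomp Require Import all_boot all_order all_algebra.
From mathcomp Require Import boolp classical_sets functions topology.

Set Implicit Arguments.
Unset Strict Implicit.
Unset Printing Implicit Defensive.

Import GRing.Theory.
Local Open Scope classical_set_scope.

Lemma sig_ext (T : Type) (P : T -> Prop) (u v : {x : T | P x}) :
  sval u = sval v -> u = v.
Proof. by case: u v => [x Px] [y Py] /= xy; exact: eq_exist. Qed.

Record category := Category {
  ob :> Type;
  mor : ob -> ob -> Type;
  mor_id : forall x, mor x x;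
  mor_comp : forall x y z, mor y z -> mor x y -> mor x z;
  mor_comp1m : forall x y (f : mor x y), mor_comp (mor_id y) f = f;
  mor_compm1 : forall x y (f : mor x y), mor_comp f (mor_id x) = f;
  mor_compA : forall x y z t (h : mor z t) (g : mor y z) (f : mor x y),
    mor_comp h (mor_comp g f) = mor_comp (mor_comp h g) f
}.
Arguments mor {c} x y.
Arguments mor_id {c} x.
Arguments mor_comp {c x y z} g f.
Notation "g \oc f" := (mor_comp g f) (at level 50, left associativity).

Definition is_iso (C : category) (x y : C) (f : mor x y) : Prop :=
  exists g : mor y x, g \oc f = mor_id x /\ f \oc g = mor_id y.

Definition op (C : category) : category := {|
  ob := ob C;
  mor := fun x y => @mor C y x;
  mor_id := fun x => @mor_id C x;
  mor_comp := fun x y z g f => @mor_comp C z y x f g;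
  mor_comp1m := fun x y f => @mor_compm1 C y x f;
  mor_compm1 := fun x y f => @mor_comp1m C y x f;
  mor_compA := fun x y z t h g f => esym (@mor_compA C t z y x f g h)
|}.

Definition full_subcategory (C : category) (P : C -> Prop) : category := {|
  ob := {x : C | P x};
  mor := fun x y => @mor C (sval x) (sval y);
  mor_id := fun x => mor_id (sval x);
  mor_comp := fun x y z g f => @mor_comp C (sval x) (sval y) (sval z) g f;
  mor_comp1m := fun x y f => @mor_comp1m C (sval x) (sval y) f;
  mor_compm1 := fun x y f => @mor_compm1 C (sval x) (sval y) f;
  mor_compA := fun x y z t h g f =>
    @mor_compA C (sval x) (sval y) (sval z) (sval t) h g f
|}.

Record functor (C D : category) := Functor {
  fob :> C -> D;
  fmap : forall x y : C, mor x y -> mor (fob x) (fob y);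
  fmap_id : forall x : C, fmap (mor_id x) = mor_id (fob x);
  fmap_comp : forall (x y z : C) (g : mor y z) (f : mor x y),
    fmap (g \oc f) = fmap g \oc fmap f
}.
Arguments fmap {C D} _ {x y} _.

Definition functor_id (C : category) : functor C C := {|
  fob := fun x : C => x;
  fmap := fun x y (f : mor x y) => f;
  fmap_id := fun x => erefl;
  fmap_comp := fun x y z g f => erefl
|}.

Lemma functor_comp_id (C D E : category) (G : functor D E) (F : functor C D)
  (x : C) : fmap G (fmap F (mor_id x)) = mor_id (G (F x)).
Proof. by rewrite !fmap_id. Qed.

Lemma functor_comp_comp (C D E : category) (G : functor D E) (F : functor C D)
    (x y z : C) (g : mor y z) (f : mor x y) :
  fmap G (fmap F (g \oc f)) = fmap G (fmap F g) \oc fmap G (fmap F f).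
Proof. by rewrite !fmap_comp. Qed.

Definition functor_comp (C D E : category) (G : functor D E) (F : functor C D) :
    functor C E := {|
  fob := fun x : C => G (F x);
  fmap := fun x y (f : mor x y) => fmap G (fmap F f);
  fmap_id := functor_comp_id G F;
  fmap_comp := functor_comp_comp G F
|}.

Record nat_trans (C D : category) (F G : functor C D) := NatTrans {
  ncomp :> forall x : C, mor (F x) (G x);
  naturality : forall (x y : C) (f : mor x y),
    ncomp y \oc fmap F f = fmap G f \oc ncomp x
}.

Lemma nat_trans_ext (C D : category) (F G : functor C D)
  (a b : nat_trans F G) : (forall x, a x = b x) -> a = b.
Proof.
case: a b => [a na] [b nb] /= ab.
have {}ab : a = b by apply: functional_extensionality_dep.
by case: _ / ab nb => nb; congr NatTrans; exact: Prop_irrelevance.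
Qed.

Lemma nat_id_naturality (C D : category) (F : functor C D)
  (x y : C) (f : mor x y) : mor_id (F y) \oc fmap F f = fmap F f \oc mor_id (F x).
Proof. by rewrite mor_comp1m mor_compm1. Qed.

Definition nat_id (C D : category) (F : functor C D) : nat_trans F F :=
  NatTrans (@nat_id_naturality C D F).

Lemma nat_comp_naturality (C D : category) (F G H : functor C D)
    (b : nat_trans G H) (a : nat_trans F G) (x y : C) (f : mor x y) :
  (b y \oc a y) \oc fmap F f = fmap H f \oc (b x \oc a x).
Proof. by rewrite -mor_compA naturality mor_compA naturality mor_compA. Qed.

Definition nat_comp (C D : category) (F G H : functor C D)
    (b : nat_trans G H) (a : nat_trans F G) : nat_trans F H :=
  NatTrans (nat_comp_naturality b a).

Lemma nat_comp1m (C D : category) (F G : functor C D) (a : nat_trans F G) :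
  nat_comp (nat_id G) a = a.
Proof. by apply: nat_trans_ext => x; exact: mor_comp1m. Qed.

Lemma nat_compm1 (C D : category) (F G : functor C D) (a : nat_trans F G) :
  nat_comp a (nat_id F) = a.
Proof. by apply: nat_trans_ext => x; exact: mor_compm1. Qed.

Lemma nat_compA (C D : category) (F G H K : functor C D)
    (c : nat_trans H K) (b : nat_trans G H) (a : nat_trans F G) :
  nat_comp c (nat_comp b a) = nat_comp (nat_comp c b) a.
Proof. by apply: nat_trans_ext => x; exact: mor_compA. Qed.

Definition functor_category (C D : category) : category := {|
  ob := functor C D;
  mor := @nat_trans C D;
  mor_id := @nat_id C D;
  mor_comp := @nat_comp C D;
  mor_comp1m := @nat_comp1m C D;
  mor_compm1 := @nat_compm1 C D;
  mor_compA := @nat_compA C D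
|}.

Definition nat_isomorphic (C D : category) (F G : functor C D) : Prop :=
  exists a : nat_trans F G, forall x, is_iso (a x).

Definition equivalent_categories (C D : category) : Prop :=
  exists (F : functor C D) (G : functor D C),
    nat_isomorphic (functor_comp G F) (functor_id C) /\
    nat_isomorphic (functor_comp F G) (functor_id D).

(* The quotient of [T] by the equivalence relation [e], realized as the type of
   equivalence classes. *)
Section Quotient.
Variables (T : Type) (e : T -> T -> Prop).

Definition quot : Type := {A : T -> Prop | exists t, A = e t}.

Definition quot_class (t : T) : quot :=
  exist _ (e t) (ex_intro _ t erefl).

Definition quot_repr (q : quot) : T := sval (cid (svalP q)).

Hypotheses (erefl_ : forall t, e t t) (esym_ : forall s t, e s t -> e t s)
  (etrans : forall s t u, e s t -> e t u -> e s u).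

Lemma quot_classP (s t : T) : quot_class s = quot_class t <-> e s t.
Proof.
split=> [[st]|st]; first by rewrite st; exact: erefl_.
apply: sig_ext; apply/funext => u; apply/propext; split; last exact: etrans.
by apply: etrans; exact: esym_.
Qed.

Lemma quot_reprK (q : quot) : quot_class (quot_repr q) = q.
Proof. by apply: sig_ext => /=; rewrite /quot_repr; case: cid. Qed.

End Quotient.

Section Localization.
Variables (C : category) (S : forall x y : C, mor x y -> Prop).

(* Finite composable words in the morphisms of [C] and formal inverses of the
   morphisms in [S]; the head of the word is applied first. *)
Inductive zigzag : C -> C -> Type :=
| znil x : zigzag x x
| zfwd x y z (f : mor x y) (p : zigzag y z) : zigzag x z
| zbwd x y z (s : mor y x) (Ss : S s) (p : zigzag y z) : zigzag x z.

Inductive zz_equiv : forall x y, zigzag x y -> zigzag x y -> Prop :=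
| zz_id x y (p : zigzag x y) : zz_equiv (zfwd (mor_id x) p) p
| zz_comp x y z t (f : mor x y) (g : mor y z) (p : zigzag z t) :
    zz_equiv (zfwd f (zfwd g p)) (zfwd (g \oc f) p)
| zz_fwdbwd x y z (s : mor x y) (Ss : S s) (p : zigzag x z) :
    zz_equiv (zfwd s (zbwd Ss p)) p
| zz_bwdfwd x y z (s : mor x y) (Ss : S s) (p : zigzag y z) :
    zz_equiv (zbwd Ss (zfwd s p)) p
| zz_refl x y (p : zigzag x y) : zz_equiv p p
| zz_sym x y (p q : zigzag x y) : zz_equiv p q -> zz_equiv q p
| zz_trans x y (p q r : zigzag x y) :
    zz_equiv p q -> zz_equiv q r -> zz_equiv p r
| zz_cfwd x y z (f : mor x y) (p q : zigzag y z) :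
    zz_equiv p q -> zz_equiv (zfwd f p) (zfwd f q)
| zz_cbwd x y z (s : mor y x) (Ss : S s) (p q : zigzag y z) :
    zz_equiv p q -> zz_equiv (zbwd Ss p) (zbwd Ss q).

Fixpoint zcat x y z (p : zigzag x y) : zigzag y z -> zigzag x z :=
  match p with
  | znil _ => id
  | zfwd _ _ _ f p => fun q => zfwd f (zcat p q)
  | zbwd _ _ _ _ Ss p => fun q => zbwd Ss (zcat p q)
  end.

Lemma zcat0 x y (p : zigzag x y) : zcat p (znil y) = p.
Proof. by elim: p => //= [? ? ? f|? ? ? s Ss] p ->. Qed.

Lemma zcatA x y z t (p : zigzag x y) (q : zigzag y z) (r : zigzag z t) :
  zcat p (zcat q r) = zcat (zcat p q) r.
Proof. by elim: p q => //= [? ? ? f|? ? ? s Ss] p IH q; rewrite IH. Qed.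

Lemma zcat_equivl x y z (p p' : zigzag x y) (q : zigzag y z) :
  zz_equiv p p' -> zz_equiv (zcat p q) (zcat p' q).
Proof.
move=> pp'; elim: pp' z q => /=.
- by move=> *; exact: zz_id.
- by move=> *; exact: zz_comp.
- by move=> *; exact: zz_fwdbwd.
- by move=> *; exact: zz_bwdfwd.
- by move=> *; exact: zz_refl.
- by move=> ? ? ? ? _ IH *; exact/zz_sym/IH.
- by move=> ? ? ? ? ? _ IH1 _ IH2 *; exact: zz_trans (IH1 _ _) (IH2 _ _).
- by move=> ? ? ? ? ? ? _ IH *; exact/zz_cfwd/IH.
- by move=> ? ? ? ? ? ? ? _ IH *; exact/zz_cbwd/IH.
Qed.

Lemma zcat_equivr x y z (p : zigzag x y) (q q' : zigzag y z) :
  zz_equiv q q' -> zz_equiv (zcat p q) (zcat p q').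
Proof.
elim: p q q' => //= [? ? ? f|? ? ? s Ss] p IH q q' /IH.
  exact: zz_cfwd.
exact: zz_cbwd.
Qed.

Definition loc_hom (x y : C) : Type := quot (@zz_equiv x y).

Definition loc_class x y (p : zigzag x y) : loc_hom x y := quot_class _ p.

Definition loc_comp x y z (g : loc_hom y z) (f : loc_hom x y) : loc_hom x z :=
  loc_class (zcat (quot_repr f) (quot_repr g)).

Lemma loc_classP x y (p q : zigzag x y) :
  loc_class p = loc_class q <-> zz_equiv p q.
Proof.
exact: (quot_classP (@zz_refl x y) (@zz_sym x y) (@zz_trans x y)).
Qed.

Lemma loc_reprK x y (f : loc_hom x y) : loc_class (quot_repr f) = f.
Proof. exact: quot_reprK. Qed.

Lemma loc_compE x y z (p : zigzag x y) (q : zigzag y z) :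
  loc_comp (loc_class q) (loc_class p) = loc_class (zcat p q).
Proof.
apply/loc_classP; apply: zz_trans (zcat_equivl _ _) (zcat_equivr _ _);
  by apply/loc_classP; exact: loc_reprK.
Qed.

Lemma loc_comp1m x y (f : loc_hom x y) : loc_comp (loc_class (znil y)) f = f.
Proof. by rewrite -(loc_reprK f) loc_compE zcat0. Qed.

Lemma loc_compm1 x y (f : loc_hom x y) : loc_comp f (loc_class (znil x)) = f.
Proof. by rewrite -(loc_reprK f) loc_compE. Qed.

Lemma loc_compA x y z t (h : loc_hom z t) (g : loc_hom y z) (f : loc_hom x y) :
  loc_comp h (loc_comp g f) = loc_comp (loc_comp h g) f.
Proof.
by rewrite -(loc_reprK f) -(loc_reprK g) -(loc_reprK h) !loc_compE zcatA.
Qed.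

(* The Gabriel-Zisman localization C[S^-1]: it has the objects of [C], and
   morphisms of [C] and formal inverses of those in [S] as generators. *)
Definition localization : category := {|
  ob := ob C;
  mor := loc_hom;
  mor_id := fun x => loc_class (znil x);
  mor_comp := loc_comp;
  mor_comp1m := loc_comp1m;
  mor_compm1 := loc_compm1;
  mor_compA := loc_compA
|}.

End Localization.

Section SerreQuotient.
Variable A : category.

Definition is_zero_object (z : A) : Prop :=
  forall x : A, (exists! f : mor z x, True) /\ (exists! f : mor x z, True).

Definition is_zero_morphism (x y : A) (f : mor x y) : Prop :=
  exists (z : A) (g : mor x z) (h : mor z y), is_zero_object z /\ f = h \oc g.

Definition is_kernel (x y : A) (f : mor x y) (k : A) (i : mor k x) : Prop :=
  is_zero_morphism (f \oc i) /\
  forall (t : A) (j : mor t x), is_zero_morphism (f \oc j) ->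
    exists! u : mor t k, i \oc u = j.

Definition is_cokernel (x y : A) (f : mor x y) (q : A) (p : mor y q) : Prop :=
  is_zero_morphism (p \oc f) /\
  forall (t : A) (j : mor y t), is_zero_morphism (j \oc f) ->
    exists! u : mor q t, u \oc p = j.

Variable B : A -> Prop.

Definition has_ker_coker_in (x y : A) (f : mor x y) : Prop :=
  (exists (k : A) (i : mor k x), is_kernel f i /\ B k) /\
  (exists (q : A) (p : mor y q), is_cokernel f p /\ B q).

(* For [A] abelian and [B] (the class of objects of) a Serre subcategory, A/B
   is the localization of [A] at the morphisms whose kernel and cokernel lie in
   [B]. *)
Definition serre_quotient : category := localization has_ker_coker_in.

End SerreQuotient.

Record sieve (C : category) (x : C) := Sieve {
  sieve_mem :> forall y : C, mor y x -> Prop;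
  sieve_closed : forall (y z : C) (f : mor y x) (g : mor z y),
    sieve_mem f -> sieve_mem (f \oc g)
}.
Arguments sieve_mem {C x} s {y} _.

Definition max_sieve (C : category) (x : C) : sieve x := {|
  sieve_mem := fun _ _ => True;
  sieve_closed := fun _ _ _ _ _ => I
|}.

Lemma pullback_sieve_closed (C : category) (x y : C) (h : mor y x) (S : sieve x)
    (z t : C) (f : mor z y) (g : mor t z) :
  sieve_mem S (h \oc f) -> sieve_mem S (h \oc (f \oc g)).
Proof. by rewrite mor_compA; exact: sieve_closed. Qed.

Definition pullback_sieve (C : category) (x y : C) (h : mor y x) (S : sieve x) :
    sieve y := {|
  sieve_mem := fun z (f : mor z y) => sieve_mem S (h \oc f);
  sieve_closed := pullback_sieve_closed (h := h) (S := S)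
|}.

Record grothendieck_topology (C : category) := GrothendieckTopology {
  covers : forall x : C, sieve x -> Prop;
  covers_max : forall x : C, covers (max_sieve x);
  covers_pullback : forall (x y : C) (f : mor y x) (S : sieve x),
    covers S -> covers (pullback_sieve f S);
  covers_trans : forall (x : C) (S T : sieve x), covers S ->
    (forall (y : C) (f : mor y x), sieve_mem S f ->
      covers (pullback_sieve f T)) ->
    covers T
}.

Arguments covers {C} g {x} S.

Record site := Site {
  site_category :> category;
  site_topology : grothendieck_topology site_category
}.

(* The condition under which the nonempty sieves form a Grothendieck topology. *)
Definition right_ore (C : category) : Prop :=
  forall (x y z : C) (f : mor y x) (g : mor z x),
    exists (w : C) (a : mor w y) (b : mor w z), f \oc a = g \oc b.

Definition nonempty_sieve (C : category) (x : C) (S : sieve x) : Prop :=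
  exists (y : C) (f : mor y x), sieve_mem S f.

Lemma nonempty_max_sieve (C : category) (x : C) :
  nonempty_sieve (max_sieve x).
Proof. by exists x, (mor_id x). Qed.

Lemma nonempty_pullback_sieve (C : category) (oreC : right_ore C) (x y : C)
    (f : mor y x) (S : sieve x) :
  nonempty_sieve S -> nonempty_sieve (pullback_sieve f S).
Proof.
move=> [z [g Sg]]; have [w [a [b fagb]]] := oreC _ _ _ f g.
by exists w, a; rewrite /= fagb; exact: sieve_closed.
Qed.

Lemma nonempty_sieve_trans (C : category) (x : C) (S T : sieve x) :
  nonempty_sieve S ->
  (forall (y : C) (f : mor y x), sieve_mem S f ->
    nonempty_sieve (pullback_sieve f T)) ->
  nonempty_sieve T.
Proof.
move=> [y [f Sf]] ST; have [z [g Tfg]] := ST _ _ Sf.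
by exists z, (f \oc g).
Qed.

Definition atomic_topology (C : category) (oreC : right_ore C) :
    grothendieck_topology C := {|
  covers := @nonempty_sieve C;
  covers_max := @nonempty_max_sieve C;
  covers_pullback := nonempty_pullback_sieve oreC;
  covers_trans := @nonempty_sieve_trans C
|}.

Definition atomic_site (C : category) (oreC : right_ore C) : site :=
  Site (atomic_topology oreC).

Section Modules.
Variable R : comPzRingType.

Lemma linear_ext (V W : lmodType R) (f g : {linear V -> W}) : f =1 g -> f = g.
Proof.
case: f g => f [[[f1 f2]] [f3]] [g [[[g1 g2]] [g3]]] /= fg.
have {}fg : f = g by exact/funext.
case: _ / fg g1 g2 g3 => g1 g2 g3.
by rewrite (Prop_irrelevance f1 g1) (Prop_irrelevance f2 g2)
  (Prop_irrelevance f3 g3).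
Qed.

Definition lin_id (V : lmodType R) : {linear V -> V} := idfun.

Definition lin_comp (U V W : lmodType R) (g : {linear V -> W})
  (f : {linear U -> V}) : {linear U -> W} := g \o f.

Lemma lin_comp1m (V W : lmodType R) (f : {linear V -> W}) :
  lin_comp (lin_id W) f = f.
Proof. exact: linear_ext. Qed.

Lemma lin_compm1 (V W : lmodType R) (f : {linear V -> W}) :
  lin_comp f (lin_id V) = f.
Proof. exact: linear_ext. Qed.

Lemma lin_compA (U V W X : lmodType R) (h : {linear W -> X})
    (g : {linear V -> W}) (f : {linear U -> V}) :
  lin_comp h (lin_comp g f) = lin_comp (lin_comp h g) f.
Proof. exact: linear_ext. Qed.

Definition module_category : category := {|
  ob := lmodType R;
  mor := fun V W => {linear V -> W};
  mor_id := lin_id;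
  mor_comp := lin_comp;
  mor_comp1m := lin_comp1m;
  mor_compm1 := lin_compm1;
  mor_compA := lin_compA
|}.

(* C-modules: covariant functors from [C] to R-modules. *)
Definition mod_category (C : category) : category :=
  functor_category C module_category.

Definition mod_at (C : category) (V : mod_category C) (x : C) : lmodType R :=
  fob V x.

Definition mod_map (C : category) (V : mod_category C) (x y : C)
  (f : mor x y) : {linear mod_at V x -> mod_at V y} := fmap V f.

Definition is_torsion (C : category) (V : mod_category C) : Prop :=
  forall (x : C) (v : mod_at V x),
    exists (y : C) (f : mor x y), mod_map V f v = 0%R.

Definition restrict (C : category) (V : mod_category (op C)) (x y : C)
  (f : mor y x) : {linear mod_at V x -> mod_at V y} := @mod_map (op C) V x y f.

Definition is_sheaf (X : site) (V : mod_category (op X)) : Prop :=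
  forall (x : X) (S : sieve x), covers (site_topology X) S ->
  forall m : forall (y : X) (f : mor y x), sieve_mem S f -> mod_at V y,
  (forall (y z : X) (f : mor y x) (g : mor z y) (Sf : sieve_mem S f)
     (Sfg : sieve_mem S (f \oc g)),
     restrict V g (m y f Sf) = m z (f \oc g) Sfg) ->
  exists! v : mod_at V x,
    forall (y : X) (f : mor y x) (Sf : sieve_mem S f),
      restrict V f v = m y f Sf.

Definition sheaf_category (X : site) : category :=
  full_subcategory (@is_sheaf X).

End Modules.

HB.mixin Record isTopologicalGroup G of Group G & Topological G := {
  mulg_continuous : continuous (fun p : G * G => (p.1 * p.2)%g);
  invg_continuous : continuous (fun x : G => x^-1%g)
}.

#[short(type="topologicalGroupType")]
HB.structure Definition TopologicalGroup :=
  {G of Group G & Topological G & isTopologicalGroup G}.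

Section OrbitCategory.
Variable G : topologicalGroupType.
Local Open Scope group_scope.

Lemma mulgl_continuous (g : G) : continuous (fun x : G => g * x).
Proof.
move=> x; apply: (@continuous_comp _ _ _ (fun x : G => (g, x))
  (fun p : G * G => p.1 * p.2)); last exact: mulg_continuous.
by apply: cvg_pair; [exact: cvg_cst|exact: cvg_id].
Qed.

Lemma mulgr_continuous (g : G) : continuous (fun x : G => x * g).
Proof.
move=> x; apply: (@continuous_comp _ _ _ (fun x : G => (x, g))
  (fun p : G * G => p.1 * p.2)); last exact: mulg_continuous.
by apply: cvg_pair; [exact: cvg_id|exact: cvg_cst].
Qed.

Record is_open_subgroup (H : set G) : Prop := {
  open_subgroup_open : open H;
  open_subgroup1 : H 1;
  open_subgroupM : forall x y, H x -> H y -> H (x * y);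
  open_subgroupV : forall x, H x -> H x^-1
}.

Definition cofinal_system (U : set (set G)) : Prop :=
  (forall H, U H -> is_open_subgroup H) /\
  (forall H, is_open_subgroup H -> exists2 K, U K & K `<=` H).

Definition translate (g : G) (A : set G) : set G := [set g * a | a in A].

Lemma translate1 (A : set G) : translate 1 A = A.
Proof.
rewrite predeqE => x; split=> [[a Aa <-]|Ax]; first by rewrite mul1g.
by exists x => //; rewrite mul1g.
Qed.

Lemma translateM (g h : G) (A : set G) :
  translate (g * h) A = translate g (translate h A).
Proof.
rewrite predeqE => x; split=> [[a Aa <-]|[_ [a Aa <-] <-]].
  by exists (h * a); [exists a|rewrite mulgA].
by exists a => //; rewrite mulgA.
Qed.

(* The set G/H of left cosets of [H], and its elements [g H]. *)
Definition cosets (H : set G) : Type := {A : set G | exists g, A = translate g H}.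

Definition coset (H : set G) (g : G) : cosets H :=
  exist _ (translate g H) (ex_intro _ g erefl).

Lemma coset_act_subproof (H : set G) (g : G) (A : cosets H) :
  exists h, translate g (sval A) = translate h H.
Proof. by have [h Ah] := svalP A; exists (g * h); rewrite Ah translateM. Qed.

Definition coset_act (H : set G) (g : G) (A : cosets H) : cosets H :=
  exist _ (translate g (sval A)) (coset_act_subproof g A).

Definition equivariant (H K : set G) (f : cosets H -> cosets K) : Prop :=
  forall g A, f (coset_act g A) = coset_act g (f A).

Definition orbit_hom (H K : set G) : Type :=
  {f : cosets H -> cosets K | equivariant f}.

Lemma orbit_hom_ext (H K : set G) (f g : orbit_hom H K) :
  (forall A, sval f A = sval g A) -> f = g.
Proof. by move=> fg; apply: sig_ext; exact/funext. Qed.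

Definition orbit_id (H : set G) : orbit_hom H H :=
  exist (@equivariant H H) id (fun _ _ => erefl).

Lemma orbit_comp_subproof (H K L : set G) (g : orbit_hom K L)
  (f : orbit_hom H K) : equivariant (sval g \o sval f).
Proof. by move=> x A /=; rewrite (svalP f) (svalP g). Qed.

Definition orbit_comp (H K L : set G) (g : orbit_hom K L) (f : orbit_hom H K) :
  orbit_hom H L :=
  exist (@equivariant H L) (sval g \o sval f) (orbit_comp_subproof g f).

Lemma orbit_comp1m (H K : set G) (f : orbit_hom H K) :
  orbit_comp (orbit_id K) f = f.
Proof. exact: orbit_hom_ext. Qed.

Lemma orbit_compm1 (H K : set G) (f : orbit_hom H K) :
  orbit_comp f (orbit_id H) = f.
Proof. exact: orbit_hom_ext. Qed.

Lemma orbit_compA (H K L M : set G) (h : orbit_hom L M) (g : orbit_hom K L)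
  (f : orbit_hom H K) :
  orbit_comp h (orbit_comp g f) = orbit_comp (orbit_comp h g) f.
Proof. exact: orbit_hom_ext. Qed.

Variable U : set (set G).

(* The object given by [H] stands for the G-set G/H. *)
Definition orbit_category : category := {|
  ob := {H : set G | U H};
  mor := fun H K => orbit_hom (sval H) (sval K);
  mor_id := fun H => orbit_id (sval H);
  mor_comp := fun H K L => @orbit_comp (sval H) (sval K) (sval L);
  mor_comp1m := fun H K => @orbit_comp1m (sval H) (sval K);
  mor_compm1 := fun H K => @orbit_compm1 (sval H) (sval K);
  mor_compA := fun H K L M =>
    @orbit_compA (sval H) (sval K) (sval L) (sval M)
|}.

Lemma coset_stab_open_subgroup (H : set G) (A : cosets H) :
  is_open_subgroup H -> is_open_subgroup [set g | coset_act g A = A].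
Proof.
case: A => A0 A0H hH; set A := exist _ _ _.
have [p Ap] := A0H.
have stabE : [set g | coset_act g A = A] = (fun g => p^-1 * (g * p)) @^-1` H.
  rewrite predeqE => g; split=> /= [/(congr1 sval) /= gA|Hg].
    move: gA; rewrite Ap => gA.
    have : translate p H (g * p).
      rewrite -gA; exists p => //; exists 1; first exact: open_subgroup1.
      by rewrite mulg1.
    by case=> h Hh <-; rewrite mulKg.
  apply: sig_ext => /=; rewrite Ap -translateM.
  have -> : g * p = p * (p^-1 * (g * p)) by rewrite mulVKg.
  rewrite translateM; congr translate; rewrite predeqE => x; split.
    by case=> h Hh <-; exact: open_subgroupM.
  move=> Hx; exists ((p^-1 * (g * p))^-1 * x); last by rewrite mulVKg.
  by apply: open_subgroupM => //; exact: open_subgroupV.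
split=> /=.
- rewrite stabE; apply: open_comp; last exact: open_subgroup_open.
  move=> x _; apply: (@continuous_comp _ _ _ (fun x : G => x * p)
    (fun x : G => p^-1 * x)); first exact: mulgr_continuous.
  exact: mulgl_continuous.
- by apply: sig_ext => /=; rewrite translate1.
- move=> x y /(congr1 sval) /= xA /(congr1 sval) /= yA.
  by apply: sig_ext => /=; rewrite translateM yA xA.
- move=> x /(congr1 sval) /= xA; apply: sig_ext => /=.
  by rewrite -{1}xA -translateM mulVg translate1.
Qed.

Lemma open_subgroupI (H K : set G) :
  is_open_subgroup H -> is_open_subgroup K -> is_open_subgroup (H `&` K).
Proof.
case=> oH H1 HM HV [oK K1 KM KV]; split=> //; first exact: openI.
  by move=> x y [? ?] [? ?]; split; [exact: HM|exact: KM].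
by move=> x [? ?]; split; [exact: HV|exact: KV].
Qed.

Lemma orbit_hom_at (M H : set G) (B : cosets H) : M 1 ->
  M `<=` [set g | coset_act g B = B] ->
  exists f : orbit_hom M H, sval f (coset M 1) = B.
Proof.
move=> M1 MB.
pose prod (A : set G) := [set a * b | a in A & b in sval B].
have prodE g : prod (translate g M) = translate g (sval B).
  rewrite predeqE => x; split=> [[_ [m Mm <-] [b Bb <-]]|[b Bb <-]].
    exists (m * b); last by rewrite mulgA.
    by rewrite -(congr1 sval (MB m Mm)); exists b.
  by exists g; [exists 1 => //; rewrite mulg1|exists b].
have prod_coset (A : cosets M) : exists h, prod (sval A) = translate h H.
  have [g ->] := svalP A; have [h Bh] := svalP B.
  by exists (g * h); rewrite prodE Bh translateM.
have eqv : equivariant (fun A => exist _ (prod (sval A)) (prod_coset A) : cosets H).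
  move=> g A; apply: sig_ext => /=; have [h ->] := svalP A.
  by rewrite -translateM !prodE translateM.
exists (exist _ _ eqv); apply: sig_ext => /=.
by rewrite prodE translate1.
Qed.

Hypothesis hU : cofinal_system U.

(* Two maps G/H -> G/K <- G/L hit the trivial coset at some A in G/H and B in
   G/L; take G/M with M in U contained in the stabilizers of A and B. *)
Lemma orbit_right_ore : right_ore orbit_category.
Proof.
have [Uopen Ucof] := hU.
have lift (H K : set G) (f : orbit_hom H K) :
    exists A : cosets H, sval f A = coset K 1.
  case fH : (sval f (coset H 1)) => [B [g Bg]].
  exists (coset_act g^-1 (coset H 1)).
  rewrite (svalP f) fH; apply: sig_ext => /=.
  by rewrite Bg -translateM mulVg.
move=> [K UK] [H UH] [L UL] /= f g.
have [A fA] := lift _ _ f; have [B gB] := lift _ _ g.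
have [M UM MAB] := Ucof _ (open_subgroupI
  (coset_stab_open_subgroup A (Uopen _ UH))
  (coset_stab_open_subgroup B (Uopen _ UL))).
have M1 := open_subgroup1 (Uopen _ UM).
have [a aA] := orbit_hom_at M1 (fun x Mx => (MAB x Mx).1).
have [b bB] := orbit_hom_at M1 (fun x Mx => (MAB x Mx).2).
exists (exist _ M UM), a, b; apply: orbit_hom_ext => X /=.
have [x Xx] := svalP X.
have -> : X = coset_act x (coset M 1).
  by apply: sig_ext; rewrite /= translate1.
by rewrite (svalP a) (svalP b) (svalP f) (svalP g) aA bB fA gB.
Qed.

Definition orbit_site : site := atomic_site orbit_right_ore.

End OrbitCategory.

Section Representations.
Variables (G : topologicalGroupType) (R : comPzRingType).

(* RG-modules, as R-modules with an R-linear (left) action of G. *)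
Record rep := Rep {
  rep_module :> lmodType R;
  rep_act : G -> {linear rep_module -> rep_module};
  rep_act1 : forall v, rep_act 1%g v = v;
  rep_actM : forall g h v, rep_act (g * h)%g v = rep_act g (rep_act h v)
}.

Arguments rep_act {r} g.

Definition intertwining (V W : rep) (f : {linear V -> W}) : Prop :=
  forall g v, f (rep_act g v) = rep_act g (f v).

Definition rep_hom (V W : rep) : Type :=
  {f : {linear V -> W} | intertwining f}.

Lemma rep_hom_ext (V W : rep) (f g : rep_hom V W) :
  (forall v, sval f v = sval g v) -> f = g.
Proof. by move=> fg; apply: sig_ext; exact: linear_ext. Qed.

Definition rep_id (V : rep) : rep_hom V V :=
  exist (@intertwining V V) (lin_id V) (fun _ _ => erefl).

Lemma rep_comp_subproof (V W X : rep) (g : rep_hom W X) (f : rep_hom V W) :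
  intertwining (lin_comp (sval g) (sval f)).
Proof. by move=> x v; rewrite /= (svalP f) (svalP g). Qed.

Definition rep_comp (V W X : rep) (g : rep_hom W X) (f : rep_hom V W) :
  rep_hom V X :=
  exist (@intertwining V X) (lin_comp (sval g) (sval f)) (rep_comp_subproof g f).

Lemma rep_comp1m (V W : rep) (f : rep_hom V W) : rep_comp (rep_id W) f = f.
Proof. exact: rep_hom_ext. Qed.

Lemma rep_compm1 (V W : rep) (f : rep_hom V W) : rep_comp f (rep_id V) = f.
Proof. exact: rep_hom_ext. Qed.

Lemma rep_compA (V W X Y : rep) (h : rep_hom X Y) (g : rep_hom W X)
    (f : rep_hom V W) :
  rep_comp h (rep_comp g f) = rep_comp (rep_comp h g) f.
Proof. exact: rep_hom_ext. Qed.

Definition rep_category : category := {|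
  ob := rep;
  mor := rep_hom;
  mor_id := rep_id;
  mor_comp := rep_comp;
  mor_comp1m := rep_comp1m;
  mor_compm1 := rep_compm1;
  mor_compA := rep_compA
|}.

Definition is_discrete (V : rep) : Prop :=
  continuous (fun p : G * discrete_topology V =>
    rep_act p.1 p.2 : discrete_topology V).

Definition stabilizer (V : rep) (v : V) : set G := [set g | rep_act g v = v].

Lemma is_discreteP (V : rep) :
  is_discrete V <-> forall v : V, open (stabilizer v).
Proof.
split=> [cV v|oV [g v]].
  have -> : stabilizer v = (fun g => rep_act g v) @^-1` [set v] by [].
  apply: (@open_comp G (discrete_topology V)); last exact: discrete_open.
  move=> g _; apply: (@continuous_comp G _ (discrete_topology V)
    (fun g : G => (g, v) : G * discrete_topology V)
    (fun p => rep_act p.1 p.2)); last exact: cV.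
  have vg : (fun=> v : discrete_topology V) @ g --> (v : discrete_topology V).
    exact: cvg_cst.
  exact: (cvg_pair (@cvg_id _ (nbhs g)) vg).
apply/(@discrete_cvg (discrete_topology V)).
exists ((fun x => g^-1 * x)%g @^-1` stabilizer v, [set v]) => /=.
  split; last exact: (@discrete_set1 (discrete_topology V)).
  apply: open_nbhs_nbhs; split.
    apply: (@open_comp G G (fun x => g^-1 * x)%g _ _ (oV v)) => x _.
    exact: mulgl_continuous.
  by rewrite /stabilizer /= mulVg rep_act1.
move=> [x w] /= [xv ->]; rewrite -{1}(mulVKg g x) rep_actM.
exact: (congr1 (rep_act g) xv).
Qed.

Definition discrete_rep_category : category :=
  @full_subcategory rep_category is_discrete.

End Representations.
Arguments rep_act {G R r} g.

(* Main.v *)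
Require Import Defs.
From HB Require Import structures.
From mathcomp Require Import all_boot all_order all_algebra.
From mathcomp Require Import boolp classical_sets functions topology.

(** The three categories are compared through a single pair of constructions
    and a single map.

    A representation [W] gives the presheaf G/H |-> {equivariant maps G/H -> W}
    ([rep_presheaf]), i.e. H |-> W^H. In the other direction, the functor
    taking G/H to its underlying set is a point of the topos, and a presheaf [V]
    has a stalk there ([stalk]): the classes of triples
    (G/H, a point A of G/H, v in V(G/H)). G acts on the stalk by moving the point A, and a germ at A is fixed by the
    open stabilizer of A, so that the stalk is a discrete representation. The
    germs of a section form an equivariant map, which is a morphism
    [stalk_unit] from [V] to the presheaf of its stalk. A section with zero
    germs restricts to zero somewhere, and an equivariant map on G/H, being
    determined by one value, is a map of germs after restriction to some G/M;
    thus the kernel and the cokernel of [stalk_unit] are torsion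
    ([stalk_unit_torsion]).

    The presheaf [rep_presheaf W] is an atomic sheaf because every map of
    orbits is onto and two points of two orbits always come from one orbit. It
    depends on a discrete [W] fully faithfully because each vector of [W] is
    fixed by some member of the cofinal system.

    The categorical half is that an atomic sheaf F is local with respect to the
    morphisms s : V -> W with torsion kernel and cokernel
    ([atomic_sheaf_local]): a section of [W] is, on a nonempty sieve, the image
    of sections of [V]; their images in F do not depend on the choices, since
    restriction is injective on an atomic sheaf, and they glue. Two formal
    consequences finish the proof.
    - A morphism with torsion kernel and cokernel between two local objects is
      an isomorphism, so [stalk_unit] is an isomorphism on sheaves and
      representations are equivalent to sheaves.
    - Morphisms into a local object do not change in the localization
      ([loc_mor_full], [loc_mor_faithful]), so sheaves embed fully faithfully in
      the Serre quotient; [stalk_unit] becomes invertible there, so every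
      presheaf is isomorphic in the quotient to a sheaf. *)

Set Implicit Arguments.
Unset Strict Implicit.
Unset Printing Implicit Defensive.

Import GRing.Theory Defs.
Local Open Scope ring_scope.

(** * Equivalences from full faithfulness *)

Section FullyFaithful.
Variables (C D : category) (F : functor C D).

Definition faithful : Prop :=
  forall (x y : C) (f g : mor x y), fmap F f = fmap F g -> f = g.

Definition full : Prop :=
  forall (x y : C) (h : mor (F x) (F y)), exists f : mor x y, fmap F f = h.

Definition essentially_surjective : Prop :=
  forall d : D, exists (c : C) (e : mor (F c) d), is_iso e.

Lemma is_iso_reflect (x y : C) (f : mor x y) :
  faithful -> full -> is_iso (fmap F f) -> is_iso f.
Proof.
move=> ffF fullF [h [hf fh]]; have [g gh] := fullF _ _ h.
by exists g; split; apply: ffF; rewrite fmap_comp gh fmap_id.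
Qed.

Hypotheses (ffF : faithful) (fullF : full) (esF : essentially_surjective).

Let lift (x y : C) (h : mor (F x) (F y)) : mor x y := sval (cid (fullF h)).

Let liftK (x y : C) (h : mor (F x) (F y)) : fmap F (lift h) = h.
Proof. by rewrite /lift; case: cid. Qed.

Let pre (d : D) : C := sval (cid (esF d)).
Let cou (d : D) : mor (F (pre d)) d := sval (cid (svalP (cid (esF d)))).
Let couP (d : D) : is_iso (cou d) := svalP (cid (svalP (cid (esF d)))).
Let inv (d : D) : mor d (F (pre d)) := sval (cid (couP d)).

Let invK (d : D) : inv d \oc cou d = mor_id _.
Proof. by rewrite /inv; case: cid => g []. Qed.

Let couK (d : D) : cou d \oc inv d = mor_id _.
Proof. by rewrite /inv; case: cid => g []. Qed.

Let premap (d d' : D) (f : mor d d') : mor (pre d) (pre d') :=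
  lift (inv d' \oc (f \oc cou d)).

Let premap_id (d : D) : premap (mor_id d) = mor_id (pre d).
Proof. by apply: ffF; rewrite liftK mor_comp1m invK fmap_id. Qed.

Let premap_comp (x y z : D) (g : mor y z) (f : mor x y) :
  premap (g \oc f) = premap g \oc premap f.
Proof.
apply: ffF; rewrite fmap_comp !liftK -!mor_compA; congr (_ \oc (_ \oc _)).
by rewrite (mor_compA (cou y)) couK mor_comp1m.
Qed.

(** The quasi-inverse chooses a preimage of each object up to isomorphism and
    transports morphisms along the chosen isomorphisms [cou]. *)
Lemma equivalence_of_fully_faithful : equivalent_categories C D.
Proof.
pose G := Functor premap_id premap_comp.
have cou_nat (x y : D) (f : mor x y) :
    cou y \oc fmap (functor_comp F G) f = fmap (functor_id D) f \oc cou x.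
  by rewrite /= liftK mor_compA couK mor_comp1m.
have unit_nat (x y : C) (f : mor x y) :
    lift (cou (F y)) \oc fmap (functor_comp G F) f =
    fmap (functor_id C) f \oc lift (cou (F x)).
  by apply: ffF; rewrite !fmap_comp /= !liftK mor_compA couK mor_comp1m.
exists F, G; split.
  exists (@NatTrans _ _ (functor_comp G F) (functor_id C)
    (fun x => lift (cou (F x))) unit_nat) => x /=.
  by apply: (is_iso_reflect ffF fullF); rewrite liftK.
by exists (@NatTrans _ _ (functor_comp F G) (functor_id D) cou cou_nat) => d /=.
Qed.

End FullyFaithful.

(** * Localization at local objects *)

Section Local.
Variables (C : category) (S : forall x y : C, mor x y -> Prop).

(** The objects that see the morphisms of [S] as isomorphisms. *)
Definition local_object (F : C) : Prop :=
  forall (x y : C) (s : mor x y), S s ->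
  forall h : mor x F, exists! k : mor y F, k \oc s = h.

(** Locality of the source extends the identity to a retraction of [s];
    uniqueness of extensions into the target makes it a section. *)
Lemma local_object_iso (x y : C) (s : mor x y) :
  S s -> local_object x -> local_object y -> is_iso s.
Proof.
move=> Ss lx ly; have [r [rs _]] := lx _ _ _ Ss (mor_id x); exists r.
have [k [_ ku]] := ly _ _ _ Ss s; split=> //.
rewrite -(ku (mor_id y)) ?mor_comp1m //.
by apply/esym/ku; rewrite -mor_compA rs mor_compm1.
Qed.

Definition loc_mor (x y : C) (f : mor x y) : @mor (localization S) x y :=
  loc_class (zfwd f (znil S y)).

Lemma loc_mor_id (x : C) : loc_mor (mor_id x) = mor_id (x : localization S).
Proof. by apply/loc_classP; exact: zz_id. Qed.

Lemma loc_mor_comp (x y z : C) (g : mor y z) (f : mor x y) :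
  loc_mor (g \oc f) = loc_mor g \oc loc_mor f.
Proof.
by rewrite /= loc_compE; apply/loc_classP/zz_sym; exact: zz_comp.
Qed.

Lemma loc_mor_iso (x y : C) (s : mor x y) : S s -> is_iso (loc_mor s).
Proof.
move=> Ss; exists (loc_class (zbwd Ss (znil S x))).
by split; rewrite /= loc_compE; apply/loc_classP;
  [exact: zz_fwdbwd|exact: zz_bwdfwd].
Qed.

Variables (F : C) (lF : local_object F).

Definition extend (x y : C) (s : mor x y) (Ss : S s) (h : mor x F) : mor y F :=
  sval (cid (lF Ss h)).

Lemma extendK (x y : C) (s : mor x y) (Ss : S s) (h : mor x F) :
  extend Ss h \oc s = h.
Proof. by rewrite /extend; case: cid => ? []. Qed.

Lemma extendE (x y : C) (s : mor x y) (Ss : S s) (k : mor y F) :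
  extend Ss (k \oc s) = k.
Proof. by rewrite /extend; case: cid => h /= [_ hu]; exact: hu. Qed.

(** The contravariant action of zigzags on the morphisms into the local object
    [F]: forward steps act by precomposition, and backward steps by the inverse
    of precomposition, that is by extension along [s]. *)
Fixpoint zz_pull (x y : C) (p : zigzag S x y) : mor y F -> mor x F :=
  match p with
  | znil _ => id
  | zfwd _ _ _ f p => fun k => zz_pull p k \oc f
  | zbwd _ _ _ _ Ss p => fun k => extend Ss (zz_pull p k)
  end.

Lemma zz_pull_equiv (x y : C) (p q : zigzag S x y) :
  zz_equiv p q -> zz_pull p = zz_pull q.
Proof.
elim=> //=.
- by move=> *; apply/funext => k; rewrite mor_compm1.
- by move=> *; apply/funext => k; rewrite mor_compA.
- by move=> *; apply/funext => k; rewrite extendK.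
- by move=> *; apply/funext => k; rewrite extendE.
- by move=> ? ? ? ? ? _ -> _ ->.
- by move=> ? ? ? ? ? ? _ ->.
- by move=> ? ? ? ? ? ? ? _ ->.
Qed.

(** Followed by a morphism into [F], a zigzag collapses to a single forward
    step: a backward step along [s] cancels the factor [s] of a morphism that
    extends along [s]. *)
Lemma zz_pullP (x y : C) (p : zigzag S x y) (k : mor y F) :
  zz_equiv (zcat p (zfwd k (znil S F))) (zfwd (zz_pull p k) (znil S F)).
Proof.
elim: p k => /= [z k|x' y' z f p IH k|x' y' z s Ss p IH k].
- exact: zz_refl.
- by apply: zz_trans (zz_cfwd _ (IH k)) _; exact: zz_comp.
- apply: zz_trans (zz_cbwd _ (IH k)) _.
  rewrite -{1}(extendK Ss (zz_pull p k)).
  apply: zz_trans (zz_cbwd _ (zz_sym (zz_comp _ _ _))) _.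
  exact: zz_bwdfwd.
Qed.

Lemma loc_mor_full (x : C) (q : @mor (localization S) x F) :
  exists f : mor x F, loc_mor f = q.
Proof.
rewrite -(loc_reprK q); move: (quot_repr q) => p.
exists (zz_pull p (mor_id F)); apply/loc_classP.
apply: zz_trans (zz_sym (zz_pullP p (mor_id F))) _.
rewrite -{2}(zcat0 p); apply: zcat_equivr; exact: zz_id.
Qed.

Lemma loc_mor_faithful (x : C) (f g : mor x F) : loc_mor f = loc_mor g -> f = g.
Proof.
move=> /loc_classP/zz_pull_equiv /(congr1 (fun k => k (mor_id F))) /=.
by rewrite !mor_comp1m.
Qed.

End Local.

(** * Submodules and quotient modules *)

Section Submodule.
Variables (R : comPzRingType) (V : lmodType R).

(** Submodules are predicates in Prop, since the ones needed below are defined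
    by existential statements; they become boolean in [sub_pred], the form on
    which substructures and quotients are built. *)
Record submodule := Submodule {
  smem :> V -> Prop;
  smem0 : smem 0;
  smemP : forall a u v, smem u -> smem v -> smem (a *: u + v)
}.

Variable P : submodule.

Lemma smemZ a u : P u -> P (a *: u).
Proof.
by move=> Pu; rewrite -[_ *: _]addr0; apply: smemP => //; exact: smem0.
Qed.

Definition sub_pred : {pred V} := fun v => `[< P v >].

Lemma sub_pred_closed : submod_closed sub_pred.
Proof.
split=> [|a u v]; rewrite -!topredE /=; first exact/asboolP/smem0.
by move=> /asboolP Pu /asboolP Pv; apply/asboolP; exact: smemP.
Qed.

HB.instance Definition _ :=
  GRing.isSubmodClosed.Build R V sub_pred sub_pred_closed.

Record sub_module := SubModule {
  sub_val : V;
  sub_valP : sub_val \in sub_pred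
}.

HB.instance Definition _ := [isSub for sub_val].
HB.instance Definition _ := [Choice of sub_module by <:].
HB.instance Definition _ := [SubChoice_isSubLmodule of sub_module by <:].

Lemma sub_module_mem (v : sub_module) : P (val v).
Proof. exact/asboolP/(valP v). Qed.

Definition sub_elt (v : V) (Pv : P v) : sub_module := SubModule (asboolT Pv).

Definition quo_module : Type := Quotient.quot sub_pred.
HB.instance Definition _ := GRing.Zmodule.on quo_module.

Definition quo_class (v : V) : quo_module := \pi_(Quotient.quot sub_pred)%qT v.
Definition quo_repr (q : quo_module) : V := repr q.

Lemma quo_classP u v : quo_class u = quo_class v <-> P (u - v).
Proof.
split=> [uv|Puv].
  have /asboolP // : u - v \in sub_pred.
  by rewrite Quotient.idealrBE; apply/eqP.
by apply/eqP; rewrite -Quotient.idealrBE; exact/asboolP.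
Qed.

Lemma quo_reprK (q : quo_module) : quo_class (quo_repr q) = q.
Proof. exact: reprK. Qed.

Lemma quo_ind (A : quo_module -> Prop) :
  (forall v, A (quo_class v)) -> forall q, A q.
Proof. by move=> Av q; rewrite -(quo_reprK q). Qed.

Lemma quo_repr_class v : P (quo_repr (quo_class v) - v).
Proof. by apply/quo_classP; rewrite quo_reprK. Qed.

Definition quo_scale a q := quo_class (a *: quo_repr q).

Lemma quo_addE u v : quo_class u + quo_class v = quo_class (u + v).
Proof. by rewrite /quo_class [RHS]Quotient.pi_add. Qed.

Lemma quo_scaleE a u : quo_scale a (quo_class u) = quo_class (a *: u).
Proof. by apply/quo_classP; rewrite -scalerBr; apply/smemZ/quo_repr_class. Qed.

Lemma quo_scaleA a b q : quo_scale a (quo_scale b q) = quo_scale (a * b) q.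
Proof. by elim/quo_ind: q => ?; rewrite !quo_scaleE scalerA. Qed.

Lemma quo_scale1 : left_id 1 quo_scale.
Proof. by elim/quo_ind=> ?; rewrite quo_scaleE scale1r. Qed.

Lemma quo_scaleDr : right_distributive quo_scale +%R.
Proof.
move=> a; do 2![elim/quo_ind=> ?].
by rewrite !(quo_scaleE, quo_addE) scalerDr.
Qed.

Lemma quo_scaleDl q : {morph quo_scale^~ q : a b / a + b}.
Proof.
by move=> a b; elim/quo_ind: q => ?; rewrite !(quo_scaleE, quo_addE) scalerDl.
Qed.

HB.instance Definition _ := GRing.Zmodule_isLmodule.Build R quo_module
  quo_scaleA quo_scale1 quo_scaleDr quo_scaleDl.

Lemma quo_class_linear : linear quo_class.
Proof. by move=> a u v; rewrite -quo_addE -quo_scaleE. Qed.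

HB.instance Definition _ :=
  GRing.isLinear.Build R V quo_module *:%R quo_class quo_class_linear.

(** Fixed names for the module structures: functors and linear maps that
    mention them then agree syntactically on the structure they use. *)
Definition sub_lmod : lmodType R := sub_module.
Definition quo_lmod : lmodType R := quo_module.

End Submodule.

Section SubmoduleMaps.
Variable R : comPzRingType.

Definition sub_incl (V : lmodType R) (P : submodule V) :
  {linear sub_lmod P -> V} := val.

Lemma sub_lift_linear (U V : lmodType R) (P : submodule V) (f : {linear U -> V})
  (Pf : forall u, P (f u)) : linear (fun u => sub_elt (Pf u) : sub_lmod P).
Proof. by move=> a u v; apply: val_inj; rewrite /= linearP. Qed.

Definition sub_lift (U V : lmodType R) (P : submodule V) (f : {linear U -> V})
  (Pf : forall u, P (f u)) : {linear U -> sub_lmod P} :=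
  HB.pack (fun u => sub_elt (Pf u))
    (GRing.isLinear.Build R U (sub_lmod P) *:%R _ (sub_lift_linear Pf)).

Definition quo_proj (V : lmodType R) (P : submodule V) :
  {linear V -> quo_lmod P} := @quo_class R V P.

Section QuoDesc.
Variables (V W : lmodType R) (P : submodule V) (f : {linear V -> W}).
Hypothesis Pf : forall v, P v -> f v = 0.

Definition quo_desc_fun (q : quo_lmod P) : W := f (quo_repr q).

Lemma quo_desc_funE v : quo_desc_fun (quo_class P v) = f v.
Proof.
by apply/eqP; rewrite -subr_eq0 -linearB; apply/eqP/Pf/quo_repr_class.
Qed.

Lemma quo_desc_linear : linear quo_desc_fun.
Proof.
move=> a; elim/quo_ind=> u; elim/quo_ind=> v.
by rewrite -linearP !quo_desc_funE linearP.
Qed.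

Definition quo_desc : {linear quo_lmod P -> W} :=
  HB.pack quo_desc_fun
    (GRing.isLinear.Build R (quo_lmod P) W *:%R _ quo_desc_linear).

Lemma quo_descE v : quo_desc (quo_class P v) = f v.
Proof. exact: quo_desc_funE. Qed.

End QuoDesc.

End SubmoduleMaps.

(** * Kernels and cokernels of maps of modules over a category *)

Section ModCategory.
Variables (R : comPzRingType) (D : category).
Local Notation DMod := (mod_category R D).

Definition mod_app (V W : DMod) (f : mor V W) (x : D) :
  {linear mod_at V x -> mod_at W x} := ncomp f x.

Lemma mod_mor_ext (V W : DMod) (f g : mor V W) :
  (forall x v, mod_app f x v = mod_app g x v) -> f = g.
Proof.
move=> fg; apply: nat_trans_ext => x; apply: linear_ext => v; exact: fg.
Qed.

Lemma mod_app_comp (V W X : DMod) (g : mor W X) (f : mor V W) x v :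
  mod_app (g \oc f) x v = mod_app g x (mod_app f x v).
Proof. by []. Qed.

Lemma mod_app_nat (V W : DMod) (f : mor V W) (x y : D) (a : mor x y) v :
  mod_app f y (mod_map V a v) = mod_map W a (mod_app f x v).
Proof.
exact: (congr1 (fun h : {linear mod_at V x -> mod_at W y} => h v)
  (naturality f a)).
Qed.

Lemma mod_map_id (V : DMod) (x : D) v : mod_map V (mor_id x) v = v.
Proof.
exact: (congr1 (fun h : {linear mod_at V x -> mod_at V x} => h v)
  (@fmap_id _ _ V x)).
Qed.

Lemma mod_map_comp (V : DMod) (x y z : D) (b : mor y z) (a : mor x y) v :
  mod_map V (b \oc a) v = mod_map V b (mod_map V a v).
Proof.
exact: (congr1 (fun h : {linear mod_at V x -> mod_at V z} => h v)
  (@fmap_comp _ _ V _ _ _ b a)).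
Qed.

Definition mod_mor (V W : DMod)
    (f : forall x, {linear mod_at V x -> mod_at W x})
    (fN : forall x y (a : mor x y) v,
      f y (mod_map V a v) = mod_map W a (f x v)) :
  mor V W := @NatTrans _ _ V W f (fun x y a =>
    @linear_ext R _ _ (lin_comp (f y) (mod_map V a))
      (lin_comp (mod_map W a) (f x)) (fN x y a)).

Section SubQuotient.
Variables (V : DMod) (P : forall x, submodule (mod_at V x)).
Hypothesis PV : forall x y (a : mor x y) v, P x v -> P y (mod_map V a v).

Let sub_map (x y : D) (a : mor x y) :
    {linear sub_lmod (P x) -> sub_lmod (P y)} :=
  @sub_lift R _ _ (P y) (lin_comp (mod_map V a) (sub_incl (P x)))
    (fun v => PV a (sub_module_mem v)).

Definition sub_functor : DMod.
Proof.
refine (@Functor D (module_category R) (fun x => sub_lmod (P x)) sub_map _ _).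
- move=> x; apply: linear_ext => v; apply: val_inj; exact: mod_map_id.
- move=> x y z g f; apply: linear_ext => v; apply: val_inj.
  exact: mod_map_comp.
Defined.

Definition sub_functor_incl : mor sub_functor V :=
  @mod_mor sub_functor V (fun x => sub_incl (P x)) (fun _ _ _ _ => erefl).

Lemma sub_functor_lift (W : DMod) (f : mor W V) :
  (forall x w, P x (mod_app f x w)) ->
  exists u : mor W sub_functor, sub_functor_incl \oc u = f.
Proof.
move=> Pf; unshelve eexists.
  apply: (@mod_mor W sub_functor (fun x => sub_lift (Pf x))) => x y a w.
  by apply: val_inj; exact: mod_app_nat.
exact: mod_mor_ext.
Qed.

Let quo_map (x y : D) (a : mor x y) :
    {linear quo_lmod (P x) -> quo_lmod (P y)}.
Proof.
apply: (@quo_desc R _ _ (P x)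
  (lin_comp (quo_proj (P y)) (mod_map V a))) => v Pv.
rewrite -(linear0 (quo_proj (P y))); apply/quo_classP.
by rewrite subr0; exact: PV.
Defined.

Lemma quo_mapE (x y : D) (a : mor x y) v :
  quo_map a (quo_class (P x) v) = quo_class (P y) (mod_map V a v).
Proof. exact: quo_descE. Qed.

Definition quo_functor : DMod.
Proof.
refine (@Functor D (module_category R) (fun x => quo_lmod (P x)) quo_map _ _).
- move=> x; apply: linear_ext; elim/quo_ind=> v.
  by rewrite [LHS]quo_mapE mod_map_id.
- move=> x y z g f; apply: linear_ext; elim/quo_ind=> v.
  have E : quo_map g (quo_map f (quo_class (P x) v)) =
      quo_class (P z) (mod_map V g (mod_map V f v)) by rewrite !quo_mapE.
  by rewrite quo_mapE mod_map_comp; exact: esym E.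
Defined.

Definition quo_functor_proj : mor V quo_functor :=
  @mod_mor V quo_functor (fun x => quo_proj (P x))
    (fun x y a v => esym (quo_mapE a v)).

Lemma quo_functor_desc (W : DMod) (f : mor V W) :
  (forall x v, P x v -> mod_app f x v = 0) ->
  exists u : mor quo_functor W, u \oc quo_functor_proj = f.
Proof.
move=> Pf; unshelve eexists.
  apply: (@mod_mor quo_functor W (fun x => quo_desc (Pf x))) => x y a.
  elim/quo_ind=> v.
  apply: etrans (congr1 (quo_desc (Pf y)) (quo_mapE a v)) _.
  by rewrite !quo_descE mod_app_nat.
by apply: mod_mor_ext => x v; exact: (quo_descE (Pf x) v).
Qed.

End SubQuotient.

Lemma submodule_zeroP (V : lmodType R) (a : R) (u v : V) :
  u = 0 -> v = 0 -> a *: u + v = 0.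
Proof. by move=> -> ->; rewrite scaler0 addr0. Qed.

Definition zero_submodule (V : lmodType R) : submodule V :=
  @Submodule R V (fun v => v = 0) erefl (@submodule_zeroP V).

Lemma zero_submodule_stable (V : DMod) x y (a : mor x y) v :
  zero_submodule (mod_at V x) v -> zero_submodule (mod_at V y) (mod_map V a v).
Proof. by move=> /= ->; rewrite linear0. Qed.

(** A zero object, obtained as the zero submodule of any [V]. *)
Definition zero_functor (V : DMod) : DMod :=
  sub_functor (@zero_submodule_stable V).

Lemma zero_functor_eq0 (V : DMod) x (v : mod_at (zero_functor V) x) : v = 0.
Proof. by apply: val_inj; exact: (sub_module_mem v). Qed.

Definition zero_mor (V W : DMod) : mor V W.
Proof.
apply: (@mod_mor V W (fun x => \0 : {linear mod_at V x -> mod_at W x})).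
by move=> x y a v; rewrite linear0.
Defined.

Lemma zero_functorP (V : DMod) : is_zero_object (zero_functor V).
Proof.
move=> W; split; exists (zero_mor _ _); split=> // f _;
  apply: mod_mor_ext => x v.
  by rewrite (zero_functor_eq0 v) !linear0.
by rewrite (zero_functor_eq0 (mod_app f x v)).
Qed.

(** On a zero object the identity equals the pointwise zero endomorphism, so
    everything that factors through it vanishes pointwise. *)
Lemma is_zero_morphismP (V W : DMod) (f : mor V W) :
  is_zero_morphism f <-> forall x v, mod_app f x v = 0.
Proof.
split=> [[Z [g [h [Z0 ->]]]] x v|f0].
  have [[i [_ iu]] _] := Z0 Z.
  have : mor_id Z = zero_mor Z Z by rewrite -(iu (mor_id Z) I); exact: iu.
  move=> /(congr1 (fun k : mor Z Z => mod_app k x (mod_app g x v))) Zg.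
  by rewrite mod_app_comp (Zg : mod_app g x v = 0) linear0.
exists (zero_functor V), (zero_mor _ _), (zero_mor _ _); split.
  exact: zero_functorP.
by apply: mod_mor_ext => x v; exact: f0.
Qed.

Section KernelCokernel.
Variables (V W : DMod) (f : mor V W).

Lemma ker_submodule_proof x a u v : mod_app f x u = 0 -> mod_app f x v = 0 ->
  mod_app f x (a *: u + v) = 0.
Proof. by move=> fu fv; rewrite linearP fu fv scaler0 addr0. Qed.

Definition ker_submodule x : submodule (mod_at V x) :=
  @Submodule R _ (fun v => mod_app f x v = 0) (linear0 _)
    (@ker_submodule_proof x).

Lemma ker_stable x y (a : mor x y) v :
  ker_submodule x v -> ker_submodule y (mod_map V a v).
Proof. by move=> /= fv; rewrite mod_app_nat fv linear0. Qed.

Lemma im_submodule_proof x a u v :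
  (exists w, mod_app f x w = u) -> (exists w, mod_app f x w = v) ->
  exists w, mod_app f x w = a *: u + v.
Proof. by move=> [u' <-] [v' <-]; exists (a *: u' + v'); rewrite linearP. Qed.

Definition im_submodule x : submodule (mod_at W x) :=
  @Submodule R _ (fun v => exists w, mod_app f x w = v)
    (ex_intro _ 0 (linear0 _)) (@im_submodule_proof x).

Lemma im_stable x y (a : mor x y) v :
  im_submodule x v -> im_submodule y (mod_map W a v).
Proof. by case=> w <-; exists (mod_map V a w); rewrite mod_app_nat. Qed.

Definition ker_functor := sub_functor ker_stable.
Definition ker_incl : mor ker_functor V := sub_functor_incl ker_stable.
Definition coker_functor := quo_functor im_stable.
Definition coker_proj : mor W coker_functor := quo_functor_proj im_stable.

Lemma ker_inclP : is_kernel f ker_incl.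
Proof.
split=> [|T j /is_zero_morphismP fj].
  by apply/is_zero_morphismP => x v; exact: (sub_module_mem v).
have [u uj] := sub_functor_lift ker_stable fj.
exists u; split=> // u' u'j; apply: mod_mor_ext => x t.
apply: val_inj; rewrite -u'j in uj.
exact: (congr1 (fun k => mod_app k x t) uj).
Qed.

Lemma coker_proj_surj x (q : mod_at coker_functor x) :
  exists w, mod_app coker_proj x w = q.
Proof. by exists (quo_repr q); exact: quo_reprK. Qed.

Lemma coker_projP : is_cokernel f coker_proj.
Proof.
split=> [|T j /is_zero_morphismP jf].
  apply/is_zero_morphismP => x v.
  rewrite mod_app_comp -(linear0 (mod_app coker_proj x)).
  by apply/quo_classP; rewrite subr0; exists v.
have jI x w : im_submodule x w -> mod_app j x w = 0.
  by case=> v <-; exact: jf.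
have [u uj] := quo_functor_desc im_stable jI.
exists u; split=> // u' u'j; apply: mod_mor_ext => x q.
have [w <-] := coker_proj_surj q; rewrite -u'j in uj.
exact: (congr1 (fun k => mod_app k x w) uj).
Qed.

Definition torsion_ker : Prop := forall x v, mod_app f x v = 0 ->
  exists (y : D) (a : mor x y), mod_map V a v = 0.

Definition torsion_coker : Prop := forall x w,
  exists (y : D) (a : mor x y) v, mod_map W a w = mod_app f y v.

(** Only the explicit kernel and cokernel can be computed with. Torsion passes
    to them from any other kernel [i] and cokernel [p]: the explicit kernel maps
    to [i] over [V], and the explicit cokernel is a quotient of [p]. *)
Lemma torsion_ker_cokerP :
  has_ker_coker_in (@is_torsion R D) f <-> torsion_ker /\ torsion_coker.
Proof.
split=> [[[K [i [[_ iu] tK]]] [Q [p [[_ pu] tQ]]]]|[tK tQ]].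
  split=> [x v fv|x w].
    have /iu[u [iuE _]] := ker_inclP.1.
    have [y [a ua]] := tK x (mod_app u x (sub_elt (fv : ker_submodule x v))).
    exists y, a; have := congr1 (mod_app i y) ua.
    rewrite linear0 mod_app_nat -mod_app_comp iuE; exact.
  have /pu[u [puE _]] := coker_projP.1.
  have [y [a pa]] := tQ x (mod_app p x w); exists y, a.
  have : mod_app coker_proj y (mod_map W a w) = 0.
    by rewrite mod_app_nat -puE mod_app_comp -mod_app_nat pa linear0.
  rewrite -(linear0 (mod_app coker_proj y)) => /quo_classP.
  by rewrite subr0 => -[v fv]; exists v.
split.
  exists ker_functor, ker_incl; split; first exact: ker_inclP.
  move=> x v; have [y [a av]] := tK x _ (sub_module_mem v).
  by exists y, a; apply: val_inj.
exists coker_functor, coker_proj; split; first exact: coker_projP.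
move=> x q; have [w <-] := coker_proj_surj q.
have [y [a [v av]]] := tQ x w; exists y, a.
rewrite -mod_app_nat av -mod_app_comp.
by have /is_zero_morphismP -> := coker_projP.1.
Qed.

End KernelCokernel.
End ModCategory.

(** * Sheaves for the atomic topology are local *)

Section AtomicSheaves.
Variables (R : comPzRingType) (C : category) (oreC : right_ore C).
Local Notation PSh := (mod_category R (op C)).

Lemma restrict_id (V : PSh) (x : C) v : restrict V (mor_id x) v = v.
Proof. exact: (@mod_map_id R (op C)). Qed.

Lemma restrict_comp (V : PSh) (x y z : C) (f : mor y x) (g : mor z y) v :
  restrict V (f \oc g) v = restrict V g (restrict V f v).
Proof. exact: (@mod_map_comp R (op C) V x y z g f). Qed.

Lemma restrict_app (V W : PSh) (s : mor V W) (x y : C) (f : mor y x) v :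
  mod_app s y (restrict V f v) = restrict W f (mod_app s x v).
Proof. exact: (@mod_app_nat R (op C) V W s x y f). Qed.

Definition generated_sieve (x y : C) (f : mor y x) : sieve x.
Proof.
exists (fun z g => exists h, g = f \oc h) => z t g k [h ->].
by exists (h \oc k); rewrite mor_compA.
Defined.

Variables (F : PSh) (sF : is_sheaf (X := atomic_site oreC) F).

(** One arrow generates a covering sieve for the atomic topology, so a section
    of a sheaf is determined by its restriction along any single arrow. *)
Lemma atomic_sheaf_separated (x y : C) (f : mor y x) (v v' : mod_at F x) :
  restrict F f v = restrict F f v' -> v = v'.
Proof.
move=> vv'; have Sf : nonempty_sieve (generated_sieve f).
  by exists y, f, (mor_id y); rewrite mor_compm1.
pose m z (g : mor z x) (_ : sieve_mem (generated_sieve f) g) := restrict F g v.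
have [w [_ wu]] : exists! w, forall z (g : mor z x)
    (Sg : sieve_mem (generated_sieve f) g), restrict F g w = m z g Sg.
  apply: (sF (S := generated_sieve f)) => // z t g h *.
  by rewrite /m restrict_comp.
rewrite -(wu v) //; apply: wu => z g Sg; rewrite /m.
by have [h ->] := Sg; rewrite !restrict_comp vv'.
Qed.

Variables (V W : PSh) (s : mor V W).
Hypotheses (tker : torsion_ker s) (tcoker : torsion_coker s).

(** The arrows along which a section [w] of [W] comes from [V]; nonempty, hence
    covering, because the cokernel of [s] is torsion. *)
Definition hit_sieve (x : C) (w : mod_at W x) : sieve x.
Proof.
exists (fun y f => exists v, restrict W f w = mod_app s y v).
move=> y z f g [v fv]; exists (restrict V g v).
by rewrite restrict_comp fv restrict_app.
Defined.

Lemma nonempty_hit_sieve (x : C) (w : mod_at W x) :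
  nonempty_sieve (hit_sieve w).
Proof. by have [y [f fw]] := tcoker w; exists y, f. Qed.

Variable h : mor V F.

(** The difference of [v] and [v'] is killed by some restriction, which is
    injective on [F]. *)
Lemma sheaf_map_torsion_ker (x : C) (v v' : mod_at V x) :
  mod_app s x v = mod_app s x v' -> mod_app h x v = mod_app h x v'.
Proof.
move=> vv'; have [|y [f fv]] := @tker x (v - v').
  by rewrite linearB vv' subrr.
apply: (@atomic_sheaf_separated x y f); rewrite -!restrict_app.
congr (mod_app h y _); apply/eqP; rewrite -subr_eq0 -linearB; exact/eqP.
Qed.

(** The value [u] that an extension of [h] along [s] must take at [w]. *)
Definition extends_at (x : C) (w : mod_at W x) (u : mod_at F x) : Prop :=
  forall (y : C) (f : mor y x) v,
    restrict W f w = mod_app s y v -> restrict F f u = mod_app h y v.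

(** The images under [h] of the preimages of the restrictions of [w] form a
    matching family on the covering sieve [hit_sieve w]. *)
Lemma extends_at_ex (x : C) (w : mod_at W x) : exists u, extends_at w u.
Proof.
pose m y (f : mor y x) (Sf : sieve_mem (hit_sieve w) f) :=
  mod_app h y (sval (cid Sf)).
have mE y (f : mor y x) Sf v :
    restrict W f w = mod_app s y v -> @m y f Sf = mod_app h y v.
  move=> fv; rewrite /m; case: cid => v' /= fv'.
  by apply: sheaf_map_torsion_ker; rewrite -fv.
have [u [uE _]] : exists! u, forall y (f : mor y x)
    (Sf : sieve_mem (hit_sieve w) f), restrict F f u = m y f Sf.
  apply: (sF (S := hit_sieve w)); first exact: nonempty_hit_sieve.
  move=> y z f g Sf Sfg; have [v fv] := Sf.
  rewrite (mE _ _ Sf _ fv) -restrict_app; apply/esym/mE.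
  by rewrite restrict_comp fv restrict_app.
exists u => y f v fv.
have Sf : sieve_mem (hit_sieve w) f by exists v.
by rewrite (uE _ _ Sf); exact: mE.
Qed.

(** The condition may be tested along one arrow [f]: any other arrow [g] can be
    compared with it over a common refinement given by the Ore condition. *)
Lemma extends_at_local (x y : C) (f : mor y x) (w : mod_at W x) v u :
  restrict W f w = mod_app s y v -> restrict F f u = mod_app h y v ->
  extends_at w u.
Proof.
move=> fw fu z g v' gw; have [t [a [b fagb]]] := oreC f g.
apply: (@atomic_sheaf_separated z t b).
rewrite -restrict_comp -fagb restrict_comp fu -!restrict_app.
apply: sheaf_map_torsion_ker.
by rewrite !restrict_app -fw -gw -!restrict_comp fagb.
Qed.

Lemma extends_at_uniq (x : C) (w : mod_at W x) u u' :
  extends_at w u -> extends_at w u' -> u = u'.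
Proof.
move=> wu wu'; have [y [f [v fw]]] := nonempty_hit_sieve w.
by apply: (@atomic_sheaf_separated x y f); rewrite (wu _ _ _ fw) (wu' _ _ _ fw).
Qed.

Lemma sheaf_extension : exists k : mor W F, k \oc s = h.
Proof.
pose k x (w : mod_at W x) := sval (cid (extends_at_ex w)).
have kP x (w : mod_at W x) : extends_at w (k x w) by rewrite /k; case: cid.
have k_lin x : linear (k x).
  move=> a w w'; apply: extends_at_uniq (kP x _) _.
  have [y [f [v fw]]] := nonempty_hit_sieve w.
  have [z [g [v' gw]]] := nonempty_hit_sieve (restrict W f w').
  apply: (@extends_at_local x z (f \oc g) _ (a *: restrict V g v + v')).
    by rewrite !linearP !restrict_comp fw gw restrict_app.
  rewrite !linearP /=; congr (_ *: _ + _).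
    by rewrite restrict_comp (kP _ _ _ _ _ fw) restrict_app.
  by apply: kP; rewrite restrict_comp.
pose kL x : {linear mod_at W x -> mod_at F x} :=
  HB.pack (k x) (GRing.isLinear.Build R _ _ *:%R _ (k_lin x)).
unshelve eexists.
  apply: (@mod_mor R (op C) W F kL) => x y f w.
  apply: extends_at_uniq (kP y _) _ => z g v.
  rewrite -[mod_map W f w]/(restrict W f w) -restrict_comp => fgw.
  rewrite -[mod_map F f _]/(restrict F f (k x w)) -restrict_comp.
  exact: kP.
apply: mod_mor_ext => x v; apply: (extends_at_uniq (kP x _)).
by apply: (@extends_at_local x x (mor_id x) _ v); rewrite restrict_id.
Qed.

Lemma sheaf_extension_uniq (k k' : mor W F) :
  k \oc s = h -> k' \oc s = h -> k = k'.
Proof.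
move=> ks k's; apply: mod_mor_ext => x w.
have [y [f [v fw]]] := nonempty_hit_sieve w.
apply: (@atomic_sheaf_separated x y f); rewrite -!restrict_app fw.
by rewrite -!mod_app_comp ks k's.
Qed.

End AtomicSheaves.

Lemma atomic_sheaf_local (R : comPzRingType) (C : category)
    (oreC : right_ore C) (F : mod_category R (op C)) :
  is_sheaf (X := atomic_site oreC) F ->
  local_object (@has_ker_coker_in (mod_category R (op C))
    (@is_torsion R (op C))) F.
Proof.
move=> sF V W s /torsion_ker_cokerP[tk tc] h.
have [k ks] := sheaf_extension sF tk tc h; exists k; split=> // k' k's.
exact: (sheaf_extension_uniq sF tc ks k's).
Qed.

(** * Points of orbits *)

Section Points.
Variables (G : topologicalGroupType) (U : set (set G)).
Hypothesis hU : cofinal_system U.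
Local Notation C := (orbit_category U).

(** A point of G/H is a coset, and [base] is the trivial one. An arrow of the
    orbit category is determined by the image of one point, so the pairs of an
    orbit and a point form a preorder, which [point_lift2] shows to be
    directed downwards. *)
Definition points (H : C) : Type := cosets (sval H).
Definition base (H : C) : points H := coset (sval H) 1%g.
Definition map_point (H K : C) (f : mor H K) : points H -> points K := sval f.

Lemma coset_actM (H : set G) (g h : G) (A : cosets H) :
  coset_act (g * h)%g A = coset_act g (coset_act h A).
Proof. by apply: sig_ext; exact: translateM. Qed.

Lemma coset_act1 (H : set G) (A : cosets H) : coset_act 1%g A = A.
Proof. by apply: sig_ext; exact: translate1. Qed.

Lemma coset_act_trans (H : set G) (A B : cosets H) :
  exists g, B = coset_act g A.
Proof.
have [x Ax] := svalP A; have [y By] := svalP B.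
exists (y * x^-1)%g; apply: sig_ext.
by rewrite /= Ax By -translateM mulgVK.
Qed.

Lemma map_point_act (H K : C) (f : mor H K) g (A : points H) :
  map_point f (coset_act g A) = coset_act g (map_point f A).
Proof. exact: (svalP f). Qed.

Lemma map_point_comp (H K L : C) (g : mor K L) (f : mor H K) (A : points H) :
  map_point (g \oc f) A = map_point g (map_point f A).
Proof. by []. Qed.

Lemma map_point_inj (H K : C) (f g : mor H K) (A : points H) :
  map_point f A = map_point g A -> f = g.
Proof.
move=> fgA; apply: orbit_hom_ext => B; have [x ->] := coset_act_trans A B.
by rewrite -!/(map_point _ _) !map_point_act fgA.
Qed.

Lemma map_point_surj (H K : C) (f : mor H K) (B : points K) :
  exists A, map_point f A = B.
Proof.
have [x Bx] := coset_act_trans (map_point f (base H)) B.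
by exists (coset_act x (base H)); rewrite map_point_act.
Qed.

Lemma point_lift (S : set G) (H : C) (A : points H) : is_open_subgroup S ->
  exists (M : C) (a : mor M H),
    (sval M `<=` S)%classic /\ map_point a (base M) = A.
Proof.
have [Uopen Ucof] := hU => oS.
have [M UM MS] := Ucof _ (open_subgroupI oS
  (coset_stab_open_subgroup A (Uopen _ (svalP H)))).
have [a aA] := orbit_hom_at (open_subgroup1 (Uopen _ UM))
  (fun x Mx => (MS x Mx).2).
by exists (exist _ M UM), a; split=> // x /MS[].
Qed.

Lemma point_lift2 (H K : C) (A : points H) (B : points K) :
  exists (M : C) (a : mor M H) (b : mor M K),
    map_point a (base M) = A /\ map_point b (base M) = B.
Proof.
have [M [a [MB aA]]] := point_lift A
  (coset_stab_open_subgroup B (hU.1 _ (svalP K))).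
have [b bB] := orbit_hom_at (open_subgroup1 (hU.1 _ (svalP M))) MB.
by exists M, a, b.
Qed.

Lemma orbit_below (S : set G) : is_open_subgroup S ->
  exists M : C, (sval M `<=` S)%classic.
Proof. by move=> /hU.2[M UM MS]; exists (exist _ M UM). Qed.

Lemma open_subgroupT : is_open_subgroup (@setT G).
Proof. by split=> //; exact: openT. Qed.

End Points.

(** * The sheaf of equivariant maps into a representation *)

Section EquivariantMaps.
Variables (G : topologicalGroupType) (R : comPzRingType) (U : set (set G)).
Hypothesis hU : cofinal_system U.
Local Notation C := (orbit_category U).
Local Notation PSh := (mod_category R (op C)).

Section Presheaf.
Variable W : rep G R.

Definition fun_lmod (H : C) : lmodType R := points H -> W.

Lemma equivariant_closed (H : C) (a : R) (u v : fun_lmod H) :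
  (forall g A, u (coset_act g A) = rep_act g (u A)) ->
  (forall g A, v (coset_act g A) = rep_act g (v A)) ->
  forall g A, (a *: u + v) (coset_act g A) = rep_act g ((a *: u + v) A).
Proof. by move=> hu hv g A; rewrite linearP -hu -hv. Qed.

Definition equivariant_submodule (H : C) : submodule (fun_lmod H) :=
  @Submodule R (fun_lmod H)
    (fun u => forall g A, u (coset_act g A) = rep_act g (u A))
    (fun g A => esym (linear0 _)) (@equivariant_closed H).

Definition equimap (H : C) : lmodType R := sub_lmod (equivariant_submodule H).

Definition equimap_at (H : C) (p : equimap H) : points H -> W := val p.

Lemma equimap_act (H : C) (p : equimap H) g A :
  equimap_at p (coset_act g A) = rep_act g (equimap_at p A).
Proof. exact: (sub_module_mem p). Qed.

(** G is transitive on its orbits. *)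
Lemma equimap_ext_at (H : C) (p q : equimap H) A :
  equimap_at p A = equimap_at q A -> p = q.
Proof.
move=> pqA; apply: val_inj; apply: funext => B.
have [x ->] := coset_act_trans A B.
by rewrite -[LHS]/(equimap_at p _) -[RHS]/(equimap_at q _) !equimap_act pqA.
Qed.

Lemma equimap_at_linear (H : C) a (p q : equimap H) A :
  equimap_at (a *: p + q) A = a *: equimap_at p A + equimap_at q A.
Proof. by rewrite /equimap_at linearP. Qed.

Definition equimap_mk (H : C) (u : points H -> W)
  (hu : forall g A, u (coset_act g A) = rep_act g (u A)) : equimap H :=
  @sub_elt R _ (equivariant_submodule H) u hu.

Lemma equimap_precomp_act (H K : C) (f : mor K H) (p : equimap H) g A :
  equimap_at p (map_point f (coset_act g A)) =
  rep_act g (equimap_at p (map_point f A)).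
Proof. by rewrite map_point_act equimap_act. Qed.

Definition equimap_precomp_fun (H K : C) (f : mor K H) (p : equimap H) :
  equimap K :=
  equimap_mk (equimap_precomp_act f p).

Lemma equimap_precomp_linear (H K : C) (f : mor K H) :
  linear (equimap_precomp_fun f).
Proof.
move=> a p q; apply: (@equimap_ext_at _ _ _ (base K)).
by rewrite equimap_at_linear; exact: equimap_at_linear.
Qed.

Definition equimap_precomp (H K : C) (f : mor K H) :
  {linear equimap H -> equimap K} :=
  HB.pack (equimap_precomp_fun f)
    (GRing.isLinear.Build R (equimap H) (equimap K) *:%R _
      (equimap_precomp_linear f)).

Definition rep_presheaf : PSh.
Proof.
refine (@Functor (op C) (module_category R) equimap
  (fun H K => @equimap_precomp H K) _ _).
- by move=> H; apply: linear_ext => p; apply: (@equimap_ext_at _ _ _ (base H)).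
- move=> H K L g f; apply: linear_ext => p.
  by apply: (@equimap_ext_at _ _ _ (base L)).
Defined.

Lemma equimap_at_restrict (H K : C) (f : mor K H)
    (p : mod_at rep_presheaf H) A :
  equimap_at (restrict rep_presheaf f p) A = equimap_at p (map_point f A).
Proof. by []. Qed.

(** A matching family containing a member on f : G/K -> G/H determines its
    amalgamation [u] because [f] is onto: [u] at [A] is the value of that member
    at any point over [A]. *)
Lemma rep_presheaf_sheaf : is_sheaf (X := orbit_site hU) rep_presheaf.
Proof.
move=> H S [K [f Sf]] m mS.
(* Two members of the family agree at points with the same image in G/H. *)
have mE (K1 K2 : C) (f1 : mor K1 H) (f2 : mor K2 H) (S1 : sieve_mem S f1)
    (S2 : sieve_mem S f2) (B1 : points K1) (B2 : points K2) :
    map_point f1 B1 = map_point f2 B2 ->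
    equimap_at (m K1 f1 S1) B1 = equimap_at (m K2 f2 S2) B2.
  move=> fB; have [M [a [b [aB bB]]]] := point_lift2 hU B1 B2.
  have fab : f1 \oc a = f2 \oc b.
    apply: (@map_point_inj _ _ _ _ _ _ (base M)).
    by rewrite !map_point_comp aB bB.
  have S1a : sieve_mem S (f1 \oc a) by exact: sieve_closed.
  have S2b : sieve_mem S (f2 \oc b) by exact: sieve_closed.
  have -> : equimap_at (m K1 f1 S1) B1 =
      equimap_at (m M (f1 \oc a) S1a) (base M).
    by rewrite -(mS _ _ _ _ S1) -aB.
  have -> : equimap_at (m K2 f2 S2) B2 =
      equimap_at (m M (f2 \oc b) S2b) (base M).
    by rewrite -(mS _ _ _ _ S2) -bB.
  by move: S1a; rewrite fab => S1a; rewrite (Prop_irrelevance S1a S2b).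
pose lift (A : points H) := sval (cid (map_point_surj f A)).
have liftK A : map_point f (lift A) = A by rewrite /lift; case: cid.
pose u A := equimap_at (m K f Sf) (lift A).
have u_act g A : u (coset_act g A) = rep_act g (u A).
  by rewrite /u -equimap_act; apply: mE; rewrite map_point_act !liftK.
exists (equimap_mk u_act); split=> [L g Sg|v vm].
  apply: (@equimap_ext_at _ _ _ (base L)); rewrite equimap_at_restrict.
  by apply: mE; rewrite liftK.
apply: (@equimap_ext_at _ _ _ (map_point f (base K))).
rewrite -!equimap_at_restrict vm equimap_at_restrict.
by apply: mE; rewrite liftK.
Qed.

End Presheaf.

Section Maps.
Variables (V W : rep G R).

Lemma equimap_postcomp_act (f : rep_hom V W) (H : C) (p : equimap V H) g A :
  sval f (equimap_at p (coset_act g A)) = rep_act g (sval f (equimap_at p A)).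
Proof. by rewrite equimap_act (svalP f). Qed.

Definition equimap_postcomp_fun (f : rep_hom V W) (H : C) (p : equimap V H) :
  equimap W H := equimap_mk (equimap_postcomp_act f p).

Lemma equimap_postcomp_linear (f : rep_hom V W) (H : C) :
  linear (@equimap_postcomp_fun f H).
Proof.
move=> a p q; apply: (@equimap_ext_at _ _ _ _ (base H)).
rewrite equimap_at_linear -[LHS]/(sval f (equimap_at _ _)).
by rewrite equimap_at_linear linearP.
Qed.

Definition equimap_postcomp (f : rep_hom V W) (H : C) :
  {linear equimap V H -> equimap W H} :=
  HB.pack (@equimap_postcomp_fun f H)
    (GRing.isLinear.Build R (equimap V H) (equimap W H) *:%R _
      (@equimap_postcomp_linear f H)).

Definition rep_presheaf_map (f : rep_hom V W) :
  mor (rep_presheaf V) (rep_presheaf W).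
Proof.
apply: (@mod_mor R (op C) (rep_presheaf V) (rep_presheaf W)
  (equimap_postcomp f)).
by move=> H K a p; apply: (@equimap_ext_at _ _ _ _ (base K)).
Defined.

Lemma equimap_at_map (f : rep_hom V W) (H : C)
    (p : mod_at (rep_presheaf V) H) A :
  equimap_at (mod_app (rep_presheaf_map f) H p) A = sval f (equimap_at p A).
Proof. by []. Qed.

Lemma open_stabilizer (v : V) :
  is_discrete V -> is_open_subgroup (stabilizer v).
Proof.
move=> /is_discreteP dV; split; first exact: dV.
- exact: rep_act1.
- by move=> x y; rewrite /stabilizer /= => xv yv; rewrite rep_actM yv xv.
- move=> x; rewrite /stabilizer /= => {1}<-.
  by rewrite -rep_actM mulVg rep_act1.
Qed.

(** The orbit map xM |-> xv, well defined because M fixes v. *)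
Lemma equimap_base (M : C) (v : V) : (sval M `<=` stabilizer v)%classic ->
  exists p : equimap V M, equimap_at p (base M) = v.
Proof.
move=> Mv.
have M1 : sval M 1%g := open_subgroup1 (hU.1 _ (svalP M)).
have gE (A : points M) : exists g, coset_act g (base M) = A.
  by have [g ->] := coset_act_trans (base M) A; exists g.
pose u (A : points M) := rep_act (sval (cid (gE A))) v.
have uE g : u (coset_act g (base M)) = rep_act g v.
  rewrite /u; case: cid => h /= hg.
  have : sval (base M) (g^-1 * h)%g.
    have hM : sval (coset_act h (base M)) h.
      by exists 1%g; rewrite ?mulg1 //; exists 1%g; rewrite ?mulg1.
    rewrite hg in hM; have [k kM <-] := hM.
    by rewrite mulKg.
  rewrite /= translate1 => /Mv /= ghv.
  by rewrite -{1}(mulVKg g h) rep_actM ghv.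
have u_act g A : u (coset_act g A) = rep_act g (u A).
  have [h <-] := gE A.
  by rewrite -coset_actM !uE rep_actM.
exists (equimap_mk u_act).
by rewrite -[LHS]/(u (base M)) -[base M in LHS]coset_act1 uE rep_act1.
Qed.

Lemma rep_presheaf_faithful (f g : rep_hom V W) : is_discrete V ->
  rep_presheaf_map f = rep_presheaf_map g -> f = g.
Proof.
move=> dV fg; apply: rep_hom_ext => v.
have [M Mv] := orbit_below hU (open_stabilizer v dV).
have [p <-] := equimap_base Mv.
by rewrite -!equimap_at_map fg.
Qed.

(** The value of [t p] at [A] depends only on the vector [equimap_at p A], by
    naturality and because two points lift to a common orbit; this gives a
    function on the vectors that are values of equivariant maps, and on a
    discrete representation every vector is one. *)
Lemma rep_presheaf_full (t : mor (rep_presheaf V) (rep_presheaf W)) :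
  is_discrete V -> exists f : rep_hom V W, rep_presheaf_map f = t.
Proof.
move=> dV.
have tE (H K : C) (p : equimap V H) (q : equimap V K) A B :
    equimap_at p A = equimap_at q B ->
    equimap_at (mod_app t H p) A = equimap_at (mod_app t K q) B.
  move=> pq; have [M [a [b [aA bB]]]] := point_lift2 hU A B.
  rewrite -aA -bB -!equimap_at_restrict -!restrict_app.
  congr (equimap_at (mod_app t M _) _).
  apply: (@equimap_ext_at _ _ _ _ (base M)).
  by rewrite !equimap_at_restrict aA bB.
have rep_ex (v : V) : exists r : W, forall (H : C) (p : equimap V H) A,
    equimap_at p A = v -> equimap_at (mod_app t H p) A = r.
  have [M Mv] := orbit_below hU (open_stabilizer v dV).
  have [p pv] := equimap_base Mv.
  exists (equimap_at (mod_app t M p) (base M)) => H q A qv.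
  by apply: tE; rewrite pv.
pose f v := sval (cid (rep_ex v)).
have fE (H : C) (p : equimap V H) A :
    f (equimap_at p A) = equimap_at (mod_app t H p) A.
  by rewrite /f; case: cid => r /= ->.
have f_lin : linear f.
  move=> a v w.
  (* Both vectors are values at one point, where linearity is that of [t]. *)
  have [M Mvw] := orbit_below hU
    (open_subgroupI (open_stabilizer v dV) (open_stabilizer w dV)).
  have [p <-] := equimap_base (fun x Mx => (Mvw x Mx).1).
  have [q <-] := equimap_base (fun x Mx => (Mvw x Mx).2).
  by rewrite -equimap_at_linear !fE linearP equimap_at_linear.
pose fL : {linear V -> W} :=
  HB.pack f (GRing.isLinear.Build R _ _ *:%R _ f_lin).
have f_act : intertwining fL.
  move=> g v; have [M Mv] := orbit_below hU (open_stabilizer v dV).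
  have [p <-] := equimap_base Mv.
  by rewrite -equimap_act [LHS]fE [X in rep_act g X]fE equimap_act.
exists (exist _ fL f_act); apply: mod_mor_ext => H p.
by apply: (@equimap_ext_at _ _ _ _ (base H)); rewrite equimap_at_map; exact: fE.
Qed.

End Maps.
End EquivariantMaps.

(** * The stalk of a presheaf *)

Section Stalk.
Variables (G : topologicalGroupType) (R : comPzRingType) (U : set (set G)).
Hypothesis hU : cofinal_system U.
Local Notation C := (orbit_category U).
Local Notation PSh := (mod_category R (op C)).
Variable V : PSh.

(** A section near a point. The fields unfold [C] and [points]: the objects of
    a category live in a universe too large for the carrier of a module. *)
Record pregerm := Pregerm {
  pregerm_ob : {H : set G | U H};
  pregerm_pt : cosets (sval pregerm_ob);
  pregerm_sec : mod_at V (pregerm_ob : C)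
}.

Definition same_germ (s t : pregerm) : Prop :=
  exists (M : C) (a : mor M (pregerm_ob s : C)) (b : mor M (pregerm_ob t : C))
    (X : points M),
    [/\ map_point a X = pregerm_pt s, map_point b X = pregerm_pt t &
        restrict V a (pregerm_sec s) = restrict V b (pregerm_sec t)].

Lemma same_germ_refl s : same_germ s s.
Proof.
by exists (pregerm_ob s : C), (mor_id _), (mor_id _), (pregerm_pt s).
Qed.

Lemma same_germ_sym s t : same_germ s t -> same_germ t s.
Proof. by move=> [M [a [b [X [aX bX ab]]]]]; exists M, b, a, X. Qed.

(** A common refinement of two comparisons of germs: the two resulting arrows to
    the middle object agree on a point, hence are equal. *)
Lemma same_germ_trans t s u : same_germ s t -> same_germ t u -> same_germ s u.
Proof.
move=> [M [a [b [X [aX bX ab]]]]] [N [c [d [Y [cY dY cd]]]]].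
have [L [x [y [xX yY]]]] := point_lift2 hU X Y.
have bc : b \oc x = c \oc y.
  apply: (@map_point_inj _ _ _ _ _ _ (base L)).
  by rewrite !map_point_comp xX yY bX cY.
exists L, (a \oc x), (d \oc y), (base L).
rewrite !map_point_comp xX yY aX dY; split=> //.
by rewrite !restrict_comp ab -cd -!restrict_comp bc.
Qed.

HB.instance Definition _ := gen_eqMixin pregerm.
HB.instance Definition _ := gen_choiceMixin pregerm.

Definition same_germ_rel : rel pregerm := fun s t => `[< same_germ s t >].

Lemma same_germ_equiv : equiv_class_of same_germ_rel.
Proof.
split=> [s|s t|t s u]; first exact/asboolP/same_germ_refl.
  by apply/idP/idP => /asboolP st; exact/asboolP/same_germ_sym.
by move=> /asboolP st /asboolP tu; apply/asboolP; exact: same_germ_trans st tu.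
Qed.

Canonical same_germ_equiv_rel := EquivRelPack same_germ_equiv.
Canonical same_germ_enc := defaultEncModRel same_germ_rel.

Definition stalk : Type := {eq_quot same_germ_rel}%qT.
HB.instance Definition _ := Choice.on stalk.

Definition germ (H : C) (A : points H) (v : mod_at V H) : stalk :=
  \pi_({eq_quot same_germ_rel})%qT (@Pregerm H A v).

Lemma germ_surj (p : stalk) : exists H (A : points H) v, p = germ A v.
Proof.
case E : (repr p : pregerm) => [H A v]; exists H, A, v.
by rewrite /germ -E reprK.
Qed.

Lemma germP (H K : C) (A : points H) (B : points K) v w :
  germ A v = germ B w <->
  exists (M : C) (a : mor M H) (b : mor M K) (X : points M),
    [/\ map_point a X = A, map_point b X = B & restrict V a v = restrict V b w].
Proof.
have E : germ A v = germ B w <-> same_germ (@Pregerm H A v) (@Pregerm K B w).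
  by split=> [/eqmodP/asboolP|vw] //; apply/eqmodP/asboolP.
exact: E.
Qed.

Lemma germ_restrict (H K : C) (f : mor K H) (B : points K) v :
  germ B (restrict V f v) = germ (map_point f B) v.
Proof.
by apply/germP; exists K, (mor_id _), f, B; split=> //; rewrite restrict_id.
Qed.

(** The form in which germs are used: finitely many of them are represented by
    sections over a single orbit, at its base point. *)
Lemma germ2 (p q : stalk) : exists (M : C) (v w : mod_at V M),
  p = germ (base M) v /\ q = germ (base M) w.
Proof.
have [H [A [v ->]]] := germ_surj p; have [K [B [w ->]]] := germ_surj q.
have [M [a [b [<- <-]]]] := point_lift2 hU A B.
by exists M, (restrict V a v), (restrict V b w); rewrite !germ_restrict.
Qed.

Lemma germ1 (p : stalk) : exists (M : C) (v : mod_at V M), p = germ (base M) v.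
Proof. by have [M [v [_ [pv _]]]] := germ2 p p; exists M, v. Qed.

Lemma germ3 (p q r : stalk) : exists (M : C) (u v w : mod_at V M),
  [/\ p = germ (base M) u, q = germ (base M) v & r = germ (base M) w].
Proof.
have [H [u [v [-> ->]]]] := germ2 p q; have [K [w ->]] := germ1 r.
have [M [a [b [aH bK]]]] := point_lift2 hU (base H) (base K).
exists M, (restrict V a u), (restrict V a v), (restrict V b w).
by rewrite !germ_restrict aH bK.
Qed.

(** The two equalities of germs may be witnessed by different pairs of arrows;
    over a common refinement those pairs coincide. *)
Lemma germ_lin_wd (H K : C) (A : points H) (B : points K) c v w v' w' :
  germ A v = germ B v' -> germ A w = germ B w' ->
  germ A (c *: v + w) = germ B (c *: v' + w').
Proof.
move=> /germP[M [a [b [X [aX bX ab]]]]] /germP[N [c' [d [Y [cY dY cd]]]]].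
have [L [x [y [xX yY]]]] := point_lift2 hU X Y.
have ac : a \oc x = c' \oc y.
  apply: (@map_point_inj _ _ _ _ _ _ (base L)).
  by rewrite !map_point_comp xX yY aX cY.
have bd : b \oc x = d \oc y.
  apply: (@map_point_inj _ _ _ _ _ _ (base L)).
  by rewrite !map_point_comp xX yY bX dY.
apply/germP; exists L, (a \oc x), (b \oc x), (base L).
rewrite !map_point_comp xX; split=> //; rewrite !linearP; congr (_ *: _ + _).
  by rewrite !restrict_comp ab.
by rewrite ac bd !restrict_comp cd.
Qed.

Lemma stalk_lin_ex (c : R) (p q : stalk) : exists r : stalk,
  forall H (A : points H) v w, p = germ A v -> q = germ A w ->
    r = germ A (c *: v + w).
Proof.
have [M [v [w [-> ->]]]] := germ2 p q.
by exists (germ (base M) (c *: v + w)) => H A v' w'; exact: germ_lin_wd.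
Qed.

(** One linear combination c p + q carries the whole module structure: addition
    is the case c = 1, and scaling the case q = 0. *)
Definition stalk_lin c p q : stalk := sval (cid (stalk_lin_ex c p q)).

Lemma stalk_linE c (H : C) (A : points H) v w :
  stalk_lin c (germ A v) (germ A w) = germ A (c *: v + w).
Proof. by rewrite /stalk_lin; case: cid => r /=; exact. Qed.

Definition stalk0 : stalk :=
  let: exist M _ := cid (orbit_below hU (open_subgroupT G)) in germ (base M) 0.

Lemma germ0 (H : C) (A : points H) : germ A 0 = stalk0.
Proof.
rewrite /stalk0; case: cid => M _; apply/germP.
have [N [a [b [aA bM]]]] := point_lift2 hU A (base M).
by exists N, a, b, (base N); rewrite !linear0.
Qed.

Definition stalk_add p q := stalk_lin 1 p q.
Definition stalk_scale c p := stalk_lin c p stalk0.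
Definition stalk_opp p := stalk_scale (-1) p.

Lemma stalk_addE (H : C) (A : points H) v w :
  stalk_add (germ A v) (germ A w) = germ A (v + w).
Proof. by rewrite /stalk_add stalk_linE scale1r. Qed.

Lemma stalk_scaleE c (H : C) (A : points H) v :
  stalk_scale c (germ A v) = germ A (c *: v).
Proof. by rewrite /stalk_scale -(germ0 A) stalk_linE addr0. Qed.

Lemma stalk_addA : associative stalk_add.
Proof.
move=> p q r; have [M [u [v [w [-> -> ->]]]]] := germ3 p q r.
by rewrite !stalk_addE addrA.
Qed.

Lemma stalk_addC : commutative stalk_add.
Proof.
move=> p q; have [M [v [w [-> ->]]]] := germ2 p q.
by rewrite !stalk_addE addrC.
Qed.

Lemma stalk_add0 : left_id stalk0 stalk_add.
Proof.
move=> p; have [M [v ->]] := germ1 p.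
by rewrite -(germ0 (base M)) stalk_addE add0r.
Qed.

Lemma stalk_addN : left_inverse stalk0 stalk_opp stalk_add.
Proof.
move=> p; have [M [v ->]] := germ1 p.
by rewrite /stalk_opp stalk_scaleE stalk_addE scaleN1r addNr germ0.
Qed.

HB.instance Definition _ :=
  GRing.isZmodule.Build stalk stalk_addA stalk_addC stalk_add0 stalk_addN.

Lemma stalk_scaleA c d p :
  stalk_scale c (stalk_scale d p) = stalk_scale (c * d) p.
Proof. by have [M [v ->]] := germ1 p; rewrite !stalk_scaleE scalerA. Qed.

Lemma stalk_scale1 : left_id 1 stalk_scale.
Proof.
by move=> p; have [M [v ->]] := germ1 p; rewrite stalk_scaleE scale1r.
Qed.

Lemma stalk_scaleDr : right_distributive stalk_scale stalk_add.
Proof.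
move=> c p q; have [M [v [w [-> ->]]]] := germ2 p q.
by rewrite !(stalk_scaleE, stalk_addE) scalerDr.
Qed.

Lemma stalk_scaleDl p :
  {morph stalk_scale^~ p : c d / c + d >-> stalk_add c d}.
Proof.
by move=> c d; have [M [v ->]] := germ1 p;
  rewrite !(stalk_scaleE, stalk_addE) scalerDl.
Qed.

HB.instance Definition _ := GRing.Zmodule_isLmodule.Build R stalk
  stalk_scaleA stalk_scale1 stalk_scaleDr stalk_scaleDl.

Definition stalk_lmod : lmodType R := stalk.

Lemma germ_linear (H : C) (A : points H) c v w :
  germ A (c *: v + w) = c *: (germ A v : stalk_lmod) + germ A w.
Proof. by rewrite -stalk_addE -stalk_scaleE. Qed.

Lemma stalk_act_ex (g : G) (p : stalk) : exists r : stalk,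
  forall H (A : points H) v,
    p = germ A v -> r = germ (coset_act g A : points H) v.
Proof.
have [M [v ->]] := germ1 p; exists (germ (coset_act g (base M) : points M) v).
move=> H A w /germP[N [a [b [X [aX bX ab]]]]]; apply/germP.
by exists N, a, b, (coset_act g X); rewrite !map_point_act aX bX.
Qed.

Definition stalk_act_fun g p : stalk := sval (cid (stalk_act_ex g p)).

Lemma stalk_actE g (H : C) (A : points H) v :
  stalk_act_fun g (germ A v) = germ (coset_act g A : points H) v.
Proof. by rewrite /stalk_act_fun; case: cid => r /=; exact. Qed.

Lemma stalk_act_linear g : linear (stalk_act_fun g : stalk_lmod -> stalk_lmod).
Proof.
move=> c p q; have [M [v [w [-> ->]]]] := germ2 p q.
by rewrite -germ_linear !stalk_actE germ_linear.
Qed.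

Definition stalk_act g : {linear stalk_lmod -> stalk_lmod} :=
  HB.pack (stalk_act_fun g)
    (GRing.isLinear.Build R stalk_lmod stalk_lmod *:%R _ (stalk_act_linear g)).

Definition stalk_rep : rep G R.
Proof.
apply: (@Rep G R stalk_lmod stalk_act).
- by move=> p; have [M [v ->]] := germ1 p; rewrite [LHS]stalk_actE coset_act1.
- move=> g h p; have [M [v ->]] := germ1 p.
  by rewrite [LHS]stalk_actE [X in _ = stalk_act g X]stalk_actE
    [RHS]stalk_actE coset_actM.
Defined.

(** The stabilizer of a germ at the base point of G/M contains the stabilizer of
    that point, so it is a neighbourhood of each of its elements. *)
Lemma stalk_rep_discrete : is_discrete stalk_rep.
Proof.
apply/is_discreteP => p; have [M [v ->]] := germ1 p.
have oS := coset_stab_open_subgroup (base M) (hU.1 _ (svalP M)).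
rewrite openE => g gp.
rewrite /interior nbhsE.
exists ((fun x => (g^-1 * x)%g) @^-1`
  [set h | coset_act h (base M) = base M])%classic.
  split; last by rewrite /= mulVg coset_act1.
  apply: open_comp (open_subgroup_open oS) => x _; exact: mulgl_continuous.
move=> x /= xM.
change (rep_act x (germ (base M) v : stalk_rep) = germ (base M) v).
rewrite -{1}(mulVKg g x) rep_actM.
have -> : rep_act (g^-1 * x)%g (germ (base M) v : stalk_rep) = germ (base M) v.
  by rewrite [LHS]stalk_actE xM.
exact: gp.
Qed.

Definition stalk_unit_at (H : C) (v : mod_at V H) : equimap stalk_rep H.
Proof.
apply: (@equimap_mk _ _ _ stalk_rep H (fun A => germ A v)) => g A.
exact/esym/stalk_actE.
Defined.

Lemma stalk_unit_linear (H : C) : linear (@stalk_unit_at H).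
Proof.
move=> c v w; apply: (@equimap_ext_at _ _ _ _ _ _ _ (base H)).
by rewrite equimap_at_linear; exact: germ_linear.
Qed.

Definition stalk_unit : mor V (rep_presheaf U stalk_rep).
Proof.
apply: (@mod_mor R (op C) V (rep_presheaf U stalk_rep) (fun H =>
  HB.pack (@stalk_unit_at H)
    (GRing.isLinear.Build R _ _ *:%R _ (@stalk_unit_linear H)))).
move=> H K f v; apply: (@equimap_ext_at _ _ _ _ _ _ _ (base K)).
exact: (germ_restrict f).
Defined.

Lemma stalk_unit_app (H : C) (v : mod_at V H) A :
  equimap_at (mod_app stalk_unit H v) A = germ A v.
Proof. by []. Qed.

Lemma stalk_unit_ker : torsion_ker stalk_unit.
Proof.
move=> H v /(congr1 (fun p : equimap stalk_rep H => equimap_at p (base H))).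
rewrite stalk_unit_app => vH.
have /germP[M [a [b [X [_ _ ab]]]]] : germ (base H) v = germ (base H) 0.
  by rewrite vH germ0.
by exists M, a; rewrite -[LHS]/(restrict V a v) ab linear0.
Qed.

(** An equivariant map [p] is determined by its value at the base point, which
    is a germ, represented over some orbit. Over a common refinement of the two
    orbits, [p] is the image of that section. *)
Lemma stalk_unit_coker : torsion_coker stalk_unit.
Proof.
move=> H p; have [K [B [w pw]]] := germ_surj (equimap_at p (base H)).
have [M [a [b [aH bB]]]] := point_lift2 hU (base H) B.
exists M, a, (restrict V b w).
apply: (@equimap_ext_at _ _ _ _ M _ _ (base M)).
rewrite stalk_unit_app germ_restrict bB -pw -aH.
exact: equimap_at_restrict.
Qed.

Lemma stalk_unit_torsion :
  has_ker_coker_in (@is_torsion R (op C)) stalk_unit.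
Proof.
apply/torsion_ker_cokerP.
by split; [exact: stalk_unit_ker|exact: stalk_unit_coker].
Qed.

End Stalk.

(** * The equivalences *)

Section Equivalences.
Variables (G : topologicalGroupType) (R : comPzRingType) (U : set (set G)).
Hypothesis hU : cofinal_system U.
Local Notation C := (orbit_category U).
Local Notation PSh := (mod_category R (op C)).
Local Notation Sh := (sheaf_category R (orbit_site hU)).
Local Notation torsion_iso := (@has_ker_coker_in PSh (@is_torsion R (op C))).

Definition rep_sheaf (W : discrete_rep_category G R) : Sh :=
  exist _ (rep_presheaf U (sval W)) (@rep_presheaf_sheaf G R U hU (sval W)).

Definition rep_sheaf_functor : functor (discrete_rep_category G R) Sh.
Proof.
refine (@Functor (discrete_rep_category G R) Sh rep_sheaf
  (fun V W f => rep_presheaf_map U f) _ _).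
- by move=> W; apply: mod_mor_ext => H p;
    apply: (@equimap_ext_at _ _ _ _ H _ _ (base H)).
- by move=> V W X g f; apply: mod_mor_ext => H p;
    apply: (@equimap_ext_at _ _ _ _ H _ _ (base H)).
Defined.

Lemma discrete_rep_sheaf_equivalence :
  equivalent_categories (discrete_rep_category G R) Sh.
Proof.
apply: (@equivalence_of_fully_faithful _ _ rep_sheaf_functor).
- by move=> V W f g; apply: (rep_presheaf_faithful hU); exact: (svalP V).
- by move=> V W t; apply: (rep_presheaf_full hU); exact: (svalP V).
move=> F; pose L := stalk_rep hU (sval F).
exists (exist _ L (@stalk_rep_discrete G R U hU (sval F))).
have sL := @rep_presheaf_sheaf G R U hU L.
have [g [gu ug]] : is_iso (stalk_unit hU (sval F)).
  apply: local_object_iso (stalk_unit_torsion hU (sval F)) _ _.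
    exact: atomic_sheaf_local (svalP F).
  exact: atomic_sheaf_local sL.
by exists g, (stalk_unit hU (sval F)).
Qed.

Definition sheaf_quotient_functor :
  functor Sh (serre_quotient (@is_torsion R (op C))).
Proof.
refine (@Functor Sh (serre_quotient (@is_torsion R (op C)))
  (fun F => sval F) (fun E F f => loc_mor torsion_iso f) _ _).
- by move=> F; exact: loc_mor_id.
- by move=> E F K g f; exact: loc_mor_comp.
Defined.

Lemma sheaf_quotient_equivalence :
  equivalent_categories Sh (serre_quotient (@is_torsion R (op C))).
Proof.
have lF (F : Sh) : local_object torsion_iso (sval F).
  exact: atomic_sheaf_local (svalP F).
apply: (@equivalence_of_fully_faithful _ _ sheaf_quotient_functor).
- by move=> E F f g; exact: (loc_mor_faithful (lF F)).
- by move=> E F q; exact: (loc_mor_full (lF F)).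
move=> V; pose L := stalk_rep hU V.
exists (exist _ (rep_presheaf U L) (@rep_presheaf_sheaf G R U hU L)).
have [g [gu ug]] :=
  @loc_mor_iso PSh torsion_iso _ _ _ (stalk_unit_torsion hU V).
by exists g, (loc_mor torsion_iso (stalk_unit hU V)).
Qed.

End Equivalences.

Theorem corollary1p4 (G : topologicalGroupType) (R : comPzRingType)
    (U : set (set G)) (hU : cofinal_system U) :
  equivalent_categories (discrete_rep_category G R)
    (sheaf_category R (orbit_site hU)) /\
  equivalent_categories (sheaf_category R (orbit_site hU))
    (serre_quotient (@is_torsion R (op (orbit_category U)))).
Proof.
split; first exact: discrete_rep_sheaf_equivalence.
exact: sheaf_quotient_equivalence.
Qed.
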